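(* Let $\kappa=-2$. Let $\bm{\lambda}=(\lambda_n)_{n\ge0}$, $\bm{\mu}=(\mu_n)_{n\ge1}$ be sequences of complex numbers for which there are integers $N\ge0$, $M\ge1$ with $\lambda_N\neq0$, $\mu_M\neq0$ and $\lambda_{N+i}=\mu_{M+i}=0$ for all $i>0$. Let $\bm{\eta}=(\eta_n)_{n\ge0}$ be a sequence of complex numbers and $P\ge0$ an integer with $\eta_P\neq0$ and $\eta_{P+i}=0$ for all $i>0$. Let $$\bm{\chi}(z)=\sum_{n=-P}^{\infty}\chi_{-n}z^{n-1}\in\mathbb{C}((z)),\qquad \chi_P\neq0,\qquad \chi_i=\eta_i\ \text{ for } i\ge0.$$ Put $q=\max\{M,N+1\}$ and $r=\max\{M+N+1,2M,P+1\}$, and let $\psi:\mathcal{P}_{q,r}\to\mathbb{C}$ be the Lie algebra homomorphism with $\psi(K)=-2$ and, for all $i\ge0$, $$\psi(e(i))=\lambda_i,\qquad \psi(h(q+i))=-2\sum_{l=1}^{M}\mu_l\lambda_{q+i-l}+\eta_{q+i},$$ $$\psi(f(r+i))=-\sum_{\substack{k_1,k_2\ge1,\ k_3\ge0 \\ k_1+k_2+k_3=r+i}}\mu_{k_1}\mu_{k_2}\lambda_{k_3}+\sum_{\substack{j_1\ge1,\ j_2\ge0 \\ j_1+j_2=r+i}}\mu_{j_1}\eta_{j_2}+2(r+i)\mu_{r+i}.$$ Then the $V^{-2}(\mathfrak{sl}_2)$-module $M_1(\bm{\lambda},\bm{\mu})\otimes L(\bm{\chi})$ is a simple quotient of the universal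 generalized Whittaker module $\widehat{R}(\psi)$.
   Context: **Affine algebra.** $\mathfrak{sl}_2$ has standard basis $e,f,h$ with $[e,f]=h$, $[h,e]=2e$, $[h,f]=-2f$ and invariant form $(e,f)=1$, $(h,h)=2$. $\widehat{\mathfrak{sl}}_2=\mathfrak{sl}_2\otimes\mathbb{C}[t,t^{-1}]\oplus\mathbb{C}K$ with $K$ central, $x(n)=x\otimes t^n$, and $[x(n),y(m)]=[x,y](n+m)+n(x,y)\delta_{n+m,0}K$. $V^{-2}(\mathfrak{sl}_2)$ is the universal affine vertex algebra at the critical level $-2$; its (weak) modules are the same as smooth $\widehat{\mathfrak{sl}}_2$-modules with $K=-2$ (smooth: for each vector $w$ and each $x\in\mathfrak{sl}_2$, $x(n)w=0$ for $n\gg0$). **Universal generalized Whittaker modules.** For integers $0<q<r$, $\mathcal{P}_{q,r}\subset\widehat{\mathfrak{sl}}_2$ is the Lie subalgebra generated by $K$ and $\{e(n),\,h(m),\,f(p)\mid n\ge0,\ m\ge q,\ p\ge r\}$. For a Lie algebra homomorphism $\psi:\mathcal{P}_{q,r}\to\mathbb{C}$, $\widehat{R}(\psi)=U(\widehat{\mathfrak{sl}}_2)\otimes_{U(\mathcal{P}_{q,r})}\mathbb{C}v$, where $x\cdot v=\psi(x)v$ for $x\in\mathcal{P}_{q,r}$. **Weyl algebra and its Whittaker modules.** $\widehat{\mathcal{A}}$ is the associative algebra generated by $a(n),a^*(n)$, $n\in\mathbb{Z}$, with only nontrivial commutators $[a(n),a^*(m)]=\delta_{n+m,0}$. For sequences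 $\bm{\lambda}=(\lambda_n)_{n\ge0}$, $\bm{\mu}=(\mu_n)_{n\ge1}$ that vanish for $n\gg0$, $M_1(\bm{\lambda},\bm{\mu})=\widehat{\mathcal{A}}/I$, where $I$ is the left ideal generated by $a(i)-\lambda_i$ $(i\ge0)$ and $a^*(j)-\mu_j$ $(j\ge1)$. The fields are $a(z)=\sum_na(n)z^{-n-1}$, $a^*(z)=\sum_na^*(n)z^{-n}$. **The module $L(\bm{\chi})$.** At the critical level the Heisenberg vertex algebra $\pi^0$ is the commutative vertex algebra generated by a field $b(z)=\sum_nb(n)z^{-n-1}$. For $\bm{\chi}(z)=\sum_n\chi_nz^{-n-1}\in\mathbb{C}((z))$, $L(\bm{\chi})$ is the one-dimensional $\pi^0$-module on which $b(n)$ acts as multiplication by $\chi_n$. **Wakimoto realization at the critical level.** With $x(z)=\sum_nx(n)z^{-n-1}$, the formulas $$e(z)=a(z),\quad h(z)=-2{:}a^*(z)a(z){:}+b(z),\quad f(z)=-{:}a^*(z)^2a(z){:}-2\,\partial_za^*(z)+a^*(z)b(z)$$ make $M_1(\bm{\lambda},\bm{\mu})\otimes L(\bm{\chi})$ a $V^{-2}(\mathfrak{sl}_2)$-module. Normal ordering is with respect to the vacuum annihilators $a(n)$ $(n\ge0)$ and $a^*(n)$ $(n\ge1)$, which are placed on the right. *)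

(* Defs.v *)
From HB Require Import structures.
From mathcomp Require Import all_boot all_order all_algebra.
From mathcomp Require Import ring_quotient.
From mathcomp Require Import finmap.
From mathcomp Require Import boolp classical_sets functions cardinality fsbigop.
From mathcomp Require Import reals complex.
From mathcomp Require Import monalg.

Set Implicit Arguments.
Unset Strict Implicit.
Unset Printing Implicit Defensive.

Import GRing.Theory.

Local Open Scope classical_set_scope.
Local Open Scope ring_scope.
Local Open Scope quotient_scope.

Section LinearExtension.
Variables (F : fieldType) (B : choiceType) (V : lmodType F).

Definition lin_ext (f : B -> V) (g : {malg F[B]}) : V :=
  \sum_(b <- msupp g) g@_b *: f b.

Lemma lin_extEw (f : B -> V) (g : {malg F[B]}) (d : {fset B}) :
  (msupp g `<=` d)%fset -> lin_ext f g = \sum_(b <- d) g@_b *: f b.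
Proof.
move=> le_d; rewrite /lin_ext (big_fset_incl _ le_d) // => b _ /mcoeff_outdom ->.
by rewrite scale0r.
Qed.

Lemma lin_ext_linear (f : B -> V) : linear (lin_ext f).
Proof.
move=> c g h; pose d := (msupp g `|` msupp h)%fset.
have sgh : (msupp (c *: g + h) `<=` d)%fset.
  apply: (fsubset_trans (msuppD_le _ _)); apply: fsetSU; exact: msuppZ_le.
rewrite (lin_extEw _ sgh) (@lin_extEw f g d) ?fsubsetUl //.
rewrite (@lin_extEw f h d) ?fsubsetUr // scaler_sumr -big_split /=.
by apply: eq_bigr => b _; rewrite mcoeffD mcoeffZ scalerDl scalerA.
Qed.

HB.instance Definition _ (f : B -> V) :=
  GRing.isLinear.Build F {malg F[B]} V *:%R (lin_ext f) (lin_ext_linear f).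

Lemma lin_extU (f : B -> V) (b : B) : lin_ext f << b >> = f b.
Proof.
by rewrite /lin_ext msuppU oner_eq0 big_seq_fset1 mcoeffUU scale1r.
Qed.

Lemma malg_lin_ind (f g : {linear {malg F[B]} -> V}) :
  (forall b, f << b >> = g << b >>) -> f =1 g.
Proof.
move=> fg x; rewrite (monalgE x) !linear_sum; apply: eq_bigr => b _.
have -> : << x@_b *g b >> = x@_b *: << b >> :> {malg F[B]}.
  by apply/malgP => k; rewrite mcoeffZ !mcoeffU mulrnAr mulr1.
by rewrite !linearZ /= fg.
Qed.

End LinearExtension.

Section QuotientSpace.
Variables (F : fieldType) (V : lmodType F) (S : set V).

(* the smallest linear subspace of V containing S *)
Definition lin_span : {pred V} :=
  fun v => `[< forall W : submodClosed V, S `<=` [set` W] -> v \in W >].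

Lemma lin_span_submod_closed : submod_closed lin_span.
Proof.
split.
  by apply/asboolP => W _; exact: rpred0.
move=> c u v /asboolP uS /asboolP vS; apply/asboolP => W SW.
by rewrite rpredD ?rpredZ ?uS ?vS.
Qed.

HB.instance Definition _ :=
  GRing.isSubmodClosed.Build F V lin_span lin_span_submod_closed.

Lemma mem_lin_span v : S v -> v \in lin_span.
Proof. by move=> Sv; apply/asboolP => W; apply. Qed.

Lemma lin_span_ind (P : V -> Prop) : P 0 ->
  (forall c u v, P u -> P v -> P (c *: u + v)) -> (forall s, S s -> P s) ->
  forall v, v \in lin_span -> P v.
Proof.
move=> P0 PD PS v /asboolP vS; pose W : {pred V} := fun u => `[< P u >].
have Wc : submod_closed W.
  split; first exact/asboolP.
  by move=> c x y /asboolP Px /asboolP Py; apply/asboolP; exact: PD.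
pose W' : submodClosed V := HB.pack W (GRing.isSubmodClosed.Build F V W Wc).
by apply/asboolP; apply: (vS W') => s Ss; apply/asboolP; exact: PS.
Qed.

Definition quot_space := Quotient.quot lin_span.

HB.instance Definition _ := GRing.Zmodule.on quot_space.

Definition quot_proj (v : V) : quot_space := \pi v.

Lemma quot_projP u v : quot_proj u = quot_proj v <-> u - v \in lin_span.
Proof. by rewrite Quotient.idealrBE; split => [/eqP|/eqP]. Qed.

Lemma quot_proj_surj (x : quot_space) : exists v, quot_proj v = x.
Proof. by exists (repr x); exact: reprK. Qed.

Lemma repr_quot_proj v : repr (quot_proj v) - v \in lin_span.
Proof. by apply/quot_projP; exact: reprK. Qed.

Lemma quot_projB : {morph quot_proj : u v / u - v}.
Proof. by move=> u v; rewrite /quot_proj !piE. Qed.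

Lemma quot_projD : {morph quot_proj : u v / u + v}.
Proof. by move=> u v; rewrite /quot_proj !piE. Qed.

Definition quot_scale (c : F) (x : quot_space) : quot_space :=
  quot_proj (c *: repr x).

Lemma quot_projZ c v : quot_proj (c *: v) = quot_scale c (quot_proj v).
Proof.
by apply/quot_projP; rewrite -scalerBr rpredZ // -opprB rpredN repr_quot_proj.
Qed.

Lemma quot_scaleA a b x : quot_scale a (quot_scale b x) = quot_scale (a * b) x.
Proof.
by case: (quot_proj_surj x) => v <-; rewrite -!quot_projZ scalerA.
Qed.

Lemma quot_scale1 : left_id 1 quot_scale.
Proof.
by move=> x; case: (quot_proj_surj x) => v <-; rewrite -!quot_projZ scale1r.
Qed.

Lemma quot_scaleDr : right_distributive quot_scale +%R.
Proof.
move=> a x y; case: (quot_proj_surj x) => u <-; case: (quot_proj_surj y) => v <-.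
by rewrite -quot_projD -!quot_projZ -quot_projD scalerDr.
Qed.

Lemma quot_scaleDl x : {morph quot_scale^~ x : a b / a + b}.
Proof.
move=> a b; case: (quot_proj_surj x) => v <-.
by rewrite -!quot_projZ -quot_projD scalerDl.
Qed.

HB.instance Definition _ := GRing.Zmodule_isLmodule.Build F quot_space
  quot_scaleA quot_scale1 quot_scaleDr quot_scaleDl.

Lemma quot_proj_linear : linear quot_proj.
Proof. by move=> c u v; rewrite quot_projD quot_projZ. Qed.

HB.instance Definition _ :=
  GRing.isLinear.Build F V quot_space *:%R quot_proj quot_proj_linear.

Lemma quot_proj_eq0 v : quot_proj v = 0 <-> v \in lin_span.
Proof. by rewrite -(linear0 quot_proj) quot_projP subr0. Qed.

End QuotientSpace.

(* [quot_lift f] and [quot_map T f] are the maps V/<S> -> W and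
   V/<S> -> W/<T> induced by f; they make sense when f maps <S> to 0,
   respectively to <T> (lemmas [quot_liftE] and [quot_mapE]). *)
Section InducedMaps.
Variables (F : fieldType) (V W : lmodType F) (S : set V) (T : set W).

Definition quot_lift (f : V -> W) (x : quot_space S) : W := f (repr x).

Definition quot_map (f : V -> W) (x : quot_space S) : quot_space T :=
  quot_proj T (f (repr x)).

Variable f : {linear V -> W}.

Lemma quot_liftE : (forall s, S s -> f s = 0) ->
  forall v, quot_lift f (quot_proj S v) = f v.
Proof.
move=> fS v; apply/eqP; rewrite -subr_eq0 -linearB; apply/eqP.
apply: (lin_span_ind _ _ fS (repr_quot_proj S v)); first exact: linear0.
by move=> c u w fu fw; rewrite linearP fu fw scaler0 addr0.
Qed.

Lemma quot_mapE : (forall s, S s -> f s \in lin_span T) ->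
  forall v, quot_map f (quot_proj S v) = quot_proj T (f v).
Proof.
move=> fS v; apply/quot_projP; rewrite -linearB.
apply: (lin_span_ind _ _ fS (repr_quot_proj S v)); first by rewrite linear0 rpred0.
by move=> c u w fu fw; rewrite linearP rpredD ?rpredZ.
Qed.

Lemma quot_lift_linear : (forall s, S s -> f s = 0) -> linear (quot_lift f).
Proof.
move=> fS c x y; case: (quot_proj_surj x) => u <-; case: (quot_proj_surj y) => v <-.
by rewrite -linearP !quot_liftE // linearP.
Qed.

Lemma quot_map_linear : (forall s, S s -> f s \in lin_span T) ->
  linear (quot_map f).
Proof.
move=> fS c x y; case: (quot_proj_surj x) => u <-; case: (quot_proj_surj y) => v <-.
by rewrite -linearP !quot_mapE // !linearP.
Qed.

End InducedMaps.

Section QuotientAlgebra.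
Variables (F : fieldType) (A : algType F) (R : set A).

Definition two_sided_ideal_gens : set A :=
  [set x | exists a s b, R s /\ x = a * s * b].

Definition quot_alg := quot_space two_sided_ideal_gens.
HB.instance Definition _ := GRing.Lmodule.on quot_alg.

Local Notation J := (lin_span two_sided_ideal_gens).
Local Notation proj := (quot_proj two_sided_ideal_gens).

Lemma ideal_mulr a x : x \in J -> x * a \in J.
Proof.
move: x; apply: lin_span_ind => [|c u v ua va|_ [b [s [d [Rs ->]]]]].
- by rewrite mul0r rpred0.
- by rewrite mulrDl -scalerAl rpredD ?rpredZ.
- by apply: mem_lin_span; exists b, s, (d * a); split; [|rewrite !mulrA].
Qed.

Lemma ideal_mull a x : x \in J -> a * x \in J.
Proof.
move: x; apply: lin_span_ind => [|c u v ua va|_ [b [s [d [Rs ->]]]]].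
- by rewrite mulr0 rpred0.
- by rewrite mulrDr -scalerAr rpredD ?rpredZ.
- by apply: mem_lin_span; exists (a * b), s, d; split; [|rewrite !mulrA].
Qed.

Definition quot_one : quot_alg := proj 1.
Definition quot_mul (x y : quot_alg) : quot_alg := proj (repr x * repr y).

Lemma quot_projM x y : quot_mul (proj x) (proj y) = proj (x * y).
Proof.
apply/quot_projP.
rewrite -[_ * _ - _](subrKA (x * repr (proj y))) -mulrBl -mulrBr.
by apply: rpredD; [apply: ideal_mulr|apply: ideal_mull]; exact: repr_quot_proj.
Qed.

Lemma quot_mulA : associative quot_mul.
Proof.
move=> x y z; case: (quot_proj_surj x) => u <-; case: (quot_proj_surj y) => v <-.
by case: (quot_proj_surj z) => w <-; rewrite !quot_projM mulrA.
Qed.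

Lemma quot_mul1 : left_id quot_one quot_mul.
Proof.
by move=> x; case: (quot_proj_surj x) => u <-; rewrite quot_projM mul1r.
Qed.

Lemma quot_mulr1 : right_id quot_one quot_mul.
Proof.
by move=> x; case: (quot_proj_surj x) => u <-; rewrite quot_projM mulr1.
Qed.

Lemma quot_mulDl : left_distributive quot_mul +%R.
Proof.
move=> x y z; case: (quot_proj_surj x) => u <-; case: (quot_proj_surj y) => v <-.
case: (quot_proj_surj z) => w <-.
by rewrite -linearD !quot_projM -linearD mulrDl.
Qed.

Lemma quot_mulDr : right_distributive quot_mul +%R.
Proof.
move=> x y z; case: (quot_proj_surj x) => u <-; case: (quot_proj_surj y) => v <-.
case: (quot_proj_surj z) => w <-.
by rewrite -linearD !quot_projM -linearD mulrDr.
Qed.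

(* Only a [pzRingType]: the ideal may contain 1. *)
HB.instance Definition _ := GRing.Zmodule_isPzRing.Build quot_alg
  quot_mulA quot_mul1 quot_mulr1 quot_mulDl quot_mulDr.

Definition quot_alg_proj (x : A) : quot_alg := proj x.
HB.instance Definition _ := GRing.isLinear.Build F A quot_alg *:%R quot_alg_proj
  (quot_proj_linear two_sided_ideal_gens).

Lemma quot_alg_proj_monoid : monoid_morphism quot_alg_proj.
Proof. by split => // x y; rewrite /quot_alg_proj -quot_projM. Qed.

HB.instance Definition _ := GRing.isMonoidMorphism.Build A quot_alg
  quot_alg_proj quot_alg_proj_monoid.

Lemma quot_alg_proj_surj (x : quot_alg) : exists a, quot_alg_proj a = x.
Proof. exact: quot_proj_surj. Qed.

Lemma quot_scaleAl (c : F) (x y : quot_alg) : c *: (x * y) = (c *: x) * y.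
Proof.
case: (quot_alg_proj_surj x) => u <-; case: (quot_alg_proj_surj y) => v <-.
by rewrite -[quot_alg_proj u * _]rmorphM -!linearZ -rmorphM /= scalerAl.
Qed.

Lemma quot_scaleAr (c : F) (x y : quot_alg) : c *: (x * y) = x * (c *: y).
Proof.
case: (quot_alg_proj_surj x) => u <-; case: (quot_alg_proj_surj y) => v <-.
by rewrite -[quot_alg_proj u * _]rmorphM -!linearZ -rmorphM /= scalerAr.
Qed.

End QuotientAlgebra.

Section FreeAlgebra.
Variables (F : fieldType) (I : choiceType).

(* noncommutative polynomials: finitely supported functions on words *)
Definition free_alg := {malg F[{fmonom I}]}.
HB.instance Definition _ := GRing.Lmodule.on free_alg.

(* the product of monoid algebras, locked to keep conversion tractable *)
Definition free_mul : free_alg -> free_alg -> free_alg := locked *%R.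

Lemma free_mulE : free_mul = *%R. Proof. by rewrite /free_mul -lock. Qed.

Definition free_one : free_alg := locked 1.

Lemma free_oneE : free_one = 1. Proof. by rewrite /free_one -lock. Qed.

Lemma free_mulA : associative free_mul.
Proof. by rewrite free_mulE; exact: mulrA. Qed.

Lemma free_mul1 : left_id free_one free_mul.
Proof. by rewrite free_mulE free_oneE; exact: mul1r. Qed.

Lemma free_mulr1 : right_id free_one free_mul.
Proof. by rewrite free_mulE free_oneE; exact: mulr1. Qed.

Lemma free_mulDl : left_distributive free_mul +%R.
Proof. by rewrite free_mulE; exact: mulrDl. Qed.

Lemma free_mulDr : right_distributive free_mul +%R.
Proof. by rewrite free_mulE; exact: mulrDr. Qed.

Lemma free_one_neq0 : free_one != 0.
Proof. by rewrite free_oneE; exact: oner_neq0. Qed.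

Lemma free_scaleAl (c : F) (x y : free_alg) :
  c *: free_mul x y = free_mul (c *: x) y.
Proof. by rewrite free_mulE; exact: scalerAl. Qed.

Lemma free_scaleAr (c : F) (x y : free_alg) :
  c *: free_mul x y = free_mul x (c *: y).
Proof.
rewrite free_mulE.
have scaleE (z : {malg F[{fmonom I}]}) : c *: z = z * c%:MP.
  by rewrite malgZ_def malgM_def fgmulgU; apply: eq_bigr => k _; rewrite mulm1 mulrC.
by rewrite -[c *: y]mul_malgC mulrA -scaleE scalerAl.
Qed.

HB.instance Definition _ := GRing.Zmodule_isNzRing.Build free_alg
  free_mulA free_mul1 free_mulr1 free_mulDl free_mulDr free_one_neq0.
HB.instance Definition _ := GRing.Lmodule_isLalgebra.Build F free_alg free_scaleAl.
HB.instance Definition _ := GRing.Lalgebra_isAlgebra.Build F free_alg free_scaleAr.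

Definition free_gen (i : I) : free_alg := locked << fmu i >>.

Lemma free_genE i : free_gen i = << fmu i >>.
Proof. by rewrite /free_gen -lock. Qed.

Definition free_lift (A : algType F) (f : I -> A) : free_alg -> A :=
  lin_ext (fun w : {fmonom I} => \prod_(i <- w) f i).
HB.instance Definition _ (A : algType F) (f : I -> A) :=
  GRing.isLinear.Build F free_alg A *:%R (free_lift f) (lin_ext_linear _).

Lemma free_lift_gen (A : algType F) (f : I -> A) i :
  free_lift f (free_gen i) = f i.
Proof. by rewrite free_genE /free_lift lin_extU fmU big_seq1. Qed.

Lemma free_lift_monoid (A : algType F) (f : I -> A) :
  monoid_morphism (free_lift f).
Proof.
have liftU c w : free_lift f << c *g w >> = c *: \prod_(i <- (w : {fmonom I})) f i.
  have -> : << c *g w >> = c *: (<< w >> : {malg F[{fmonom I}]}).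
    by apply/malgP => k; rewrite mcoeffZ !mcoeffU mulrnAr mulr1.
  by rewrite [LHS]linearZ /= /free_lift lin_extU.
split; first by rewrite -[1]/free_one free_oneE liftU fm1 big_nil scale1r.
move=> x y; rewrite -[x * y]/(free_mul x y) free_mulE [_ x y]malgME [in RHS](monalgE x) [in RHS](monalgE y).
rewrite !raddf_sum /= mulr_suml; apply: eq_bigr => u _.
rewrite raddf_sum /= mulr_sumr; apply: eq_bigr => v _.
by rewrite !liftU fmM big_cat /= -scalerAl -scalerAr scalerA.
Qed.

HB.instance Definition _ (A : algType F) (f : I -> A) :=
  GRing.isMonoidMorphism.Build free_alg A (free_lift f) (free_lift_monoid f).

End FreeAlgebra.

HB.mixin Record Lmodule_isLieAlgebra (F : fieldType) L of GRing.Lmodule F L := {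
  lie : L -> L -> L;
  lie_linearl : forall z, linear (lie^~ z);
  lie_linearr : forall z, linear (lie z);
  liexx : forall x, lie x x = 0;
  lie_jacobi : forall x y z,
    lie x (lie y z) + lie y (lie z x) + lie z (lie x y) = 0
}.

#[short(type="lieAlgType")]
HB.structure Definition LieAlgebra (F : fieldType) :=
  {L of GRing.Lmodule F L & Lmodule_isLieAlgebra F L}.

HB.instance Definition _ (F : fieldType) (L : lieAlgType F) (x : L) :=
  GRing.isLinear.Build F L L *:%R (lie x) (lie_linearr x).

(* Lie algebra homomorphisms L -> A for the commutator bracket of A. For
   A := F^o that bracket is zero, so these are the characters of L. *)
Record lie_hom (F : fieldType) (L : lieAlgType F) (A : algType F) := LieHom {
  lie_hom_fun :> {linear L -> A};
  lie_homE : forall x y, lie_hom_fun (lie x y) =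
    lie_hom_fun x * lie_hom_fun y - lie_hom_fun y * lie_hom_fun x
}.

Section LieSubalgebra.
Variables (F : fieldType) (L : lieAlgType F) (S : set L).

Definition lie_closed (W : {pred L}) := {in W &, forall x y, lie x y \in W}.

(* the smallest Lie subalgebra of L containing S *)
Definition lie_span : {pred L} := fun x =>
  `[< forall W : submodClosed L, lie_closed W -> S `<=` [set` W] -> x \in W >].

Lemma lie_span_submod_closed : submod_closed lie_span.
Proof.
split; first by apply/asboolP => W _ _; exact: rpred0.
move=> c u v /asboolP uS /asboolP vS; apply/asboolP => W lW SW.
by rewrite rpredD ?rpredZ ?uS ?vS.
Qed.

HB.instance Definition _ :=
  GRing.isSubmodClosed.Build F L lie_span lie_span_submod_closed.

Lemma lie_span_closed : lie_closed lie_span.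
Proof.
move=> x y /asboolP xS /asboolP yS; apply/asboolP => W lW SW.
exact: lW (xS W lW SW) (yS W lW SW).
Qed.

Lemma mem_lie_span x : S x -> x \in lie_span.
Proof. by move=> Sx; apply/asboolP => W _; apply. Qed.

Record lie_sub := LieSub { lie_sub_val : L; lie_subP : lie_sub_val \in lie_span }.

HB.instance Definition _ := [isSub for lie_sub_val].
HB.instance Definition _ := [Choice of lie_sub by <:].
HB.instance Definition _ := [SubChoice_isSubLmodule of lie_sub by <:].

Definition sub_lie (x y : lie_sub) : lie_sub :=
  LieSub (lie_span_closed (lie_subP x) (lie_subP y)).

Lemma sub_lie_linearl z : linear (sub_lie^~ z).
Proof.
move=> c x y; apply: val_inj; rewrite linearP /=; exact: lie_linearl.
Qed.

Lemma sub_lie_linearr z : linear (sub_lie z).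
Proof.
move=> c x y; apply: val_inj; rewrite linearP /=; exact: lie_linearr.
Qed.

Lemma sub_liexx x : sub_lie x x = 0.
Proof. by apply: val_inj; rewrite linear0 /= liexx. Qed.

Lemma sub_lie_jacobi x y z :
  sub_lie x (sub_lie y z) + sub_lie y (sub_lie z x) + sub_lie z (sub_lie x y) = 0.
Proof. by apply: val_inj; rewrite !linearD linear0 /= lie_jacobi. Qed.

HB.instance Definition _ := Lmodule_isLieAlgebra.Build F lie_sub
  sub_lie_linearl sub_lie_linearr sub_liexx sub_lie_jacobi.

End LieSubalgebra.

Section EnvelopingAlgebra.
Variables (F : fieldType) (L : lieAlgType F).

Local Notation T := (free_alg F L).
Local Notation gen := (@free_gen F L).

(* The generators are all the elements of L; the first family of relations
   makes L -> U(L) linear. *)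
Definition uea_rels : set T :=
  [set t | exists c x y, t = gen (c *: x + y) - (c *: gen x + gen y)] `|`
  [set t | exists x y, t = gen x * gen y - gen y * gen x - gen (lie x y)].

Definition uea := quot_alg uea_rels.
HB.instance Definition _ := GRing.PzRing.on uea.
HB.instance Definition _ := GRing.Lmodule.on uea.

Definition uea_in (x : L) : uea := quot_alg_proj uea_rels (gen x).

Lemma uea_in_linear : linear uea_in.
Proof.
move=> c x y; rewrite /uea_in -linearP; apply/quot_projP/mem_lin_span.
exists 1, (gen (c *: x + y) - (c *: gen x + gen y)), 1.
by split; [left; exists c, x, y|rewrite mul1r mulr1].
Qed.

HB.instance Definition _ := GRing.isLinear.Build F L uea *:%R uea_in uea_in_linear.

Lemma uea_inE x y : uea_in (lie x y) = uea_in x * uea_in y - uea_in y * uea_in x.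
Proof.
rewrite /uea_in -!rmorphM -rmorphB; apply/esym/quot_projP/mem_lin_span.
exists 1, (gen x * gen y - gen y * gen x - gen (lie x y)), 1.
by split; [right; exists x, y|rewrite mul1r mulr1].
Qed.

Lemma free_lift_uea_rels (A : algType F) (f : lie_hom L A) s :
  two_sided_ideal_gens uea_rels s -> @free_lift F L A f s = 0.
Proof.
case=> a [t [b [tR ->]]]; suff ft : @free_lift F L A f t = 0.
  by rewrite !rmorphM /= ft mulr0 mul0r.
case: tR => [[c [x [y ->]]]|[x [y ->]]].
  by rewrite linearB linearP /= !free_lift_gen linearP subrr.
have fM u v : @free_lift F L A f (gen u * gen v) = f u * f v.
  by rewrite (rmorphM (@free_lift F L A f)) /= !free_lift_gen.
by rewrite linearB /= linearB /= 2!fM free_lift_gen lie_homE subrr.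
Qed.

(* the algebra homomorphism U(L) -> A extending f *)
Definition uea_lift (A : algType F) (f : lie_hom L A) : uea -> A :=
  quot_lift (@free_lift F L A f).

Lemma uea_lift_proj (A : algType F) (f : lie_hom L A) t :
  uea_lift f (quot_alg_proj uea_rels t) = @free_lift F L A f t.
Proof. exact: quot_liftE (@free_lift_uea_rels A f) t. Qed.

Lemma uea_nonzero : 1 != 0 :> uea.
Proof.
have f : lie_hom L F^o.
  by exists (\0 : {linear L -> F^o}) => x y /=; rewrite mulr0 subrr.
apply/eqP => /(congr1 (uea_lift f)); rewrite -[1](rmorph1 (quot_alg_proj _)).
rewrite -[0](linear0 (quot_alg_proj uea_rels)) !uea_lift_proj rmorph1 linear0.
by apply/eqP; exact: oner_neq0.
Qed.

HB.instance Definition _ := GRing.PzSemiRing_isNonZero.Build uea uea_nonzero.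
HB.instance Definition _ := GRing.Lmodule_isLalgebra.Build F uea
  (@quot_scaleAl _ _ uea_rels).
HB.instance Definition _ := GRing.Lalgebra_isAlgebra.Build F uea
  (@quot_scaleAr _ _ uea_rels).

Section Lift.
Variables (A : algType F) (f : lie_hom L A).

Local Notation lift := (uea_lift f).

Lemma uea_lift_linear : linear lift.
Proof. exact: quot_lift_linear (@free_lift_uea_rels A f). Qed.

HB.instance Definition _ := GRing.isLinear.Build F uea A *:%R
  lift uea_lift_linear.

Lemma uea_lift_monoid : monoid_morphism lift.
Proof.
split; first by rewrite -[1](rmorph1 (quot_alg_proj _)) uea_lift_proj rmorph1.
move=> x y; case: (quot_alg_proj_surj x) => u <-.
case: (quot_alg_proj_surj y) => v <-.
by rewrite -[_ * _ in LHS]rmorphM !uea_lift_proj rmorphM.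
Qed.

HB.instance Definition _ := GRing.isMonoidMorphism.Build uea A
  lift uea_lift_monoid.

Lemma uea_lift_in x : lift (uea_in x) = f x.
Proof. by rewrite uea_lift_proj free_lift_gen. Qed.

End Lift.

End EnvelopingAlgebra.

Section BalancedTensor.
Variables (F : fieldType) (V W : lmodType F) (S : Type).
Variables (ract : V -> S -> V) (lact : S -> W -> W).

Local Notation T := {malg F[(V * W)%type]}.
Local Notation "v '*t' w" := (<< (v, w) >> : T) (at level 40).

Definition tensor_rels : set T :=
  [set t | exists c v v' w,
     t = (c *: v + v') *t w - (c *: (v *t w) + v' *t w)] `|`
  [set t | exists c v w w',
     t = v *t (c *: w + w') - (c *: (v *t w) + v *t w')] `|`
  [set t | exists v s w, t = ract v s *t w - v *t lact s w].

(* V (x)_S W for a right action of S on V and a left action of S on W *)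
Definition tensor := quot_space tensor_rels.
HB.instance Definition _ := GRing.Lmodule.on tensor.

Definition pure_tensor (v : V) (w : W) : tensor := quot_proj tensor_rels (v *t w).

End BalancedTensor.

Section TensorMap.
Variables (F : fieldType) (V V' W W' : lmodType F) (S : Type).
Variables (ract : V -> S -> V) (lact : S -> W -> W).
Variables (ract' : V' -> S -> V') (lact' : S -> W' -> W').

(* the map f (x) g, well defined for S-linear f and g ([tensor_mapE]) *)
Definition tensor_map (f : V -> V') (g : W -> W') :
  tensor ract lact -> tensor ract' lact' :=
  quot_map (tensor_rels ract' lact') (lin_ext (fun vw : (V * W)%type => << (f vw.1, g vw.2) >>)).

Lemma tensor_mapE (f : {linear V -> V'}) (g : {linear W -> W'}) :
  (forall v s, f (ract v s) = ract' (f v) s) ->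
  (forall s w, g (lact s w) = lact' s (g w)) ->
  forall v w, tensor_map f g (pure_tensor ract lact v w) =
              pure_tensor ract' lact' (f v) (g w).
Proof.
move=> fS gS v w; rewrite /tensor_map quot_mapE /= ?lin_extU //.
move=> _ [[[c [v1 [v2 [w1 ->]]]]|[c [v1 [w1 [w2 ->]]]]]|[v1 [s [w1 ->]]]].
- rewrite linearB linearP /= !lin_extU /= linearP.
  by apply: mem_lin_span; left; left; exists c, (f v1), (f v2), (g w1).
- rewrite linearB linearP /= !lin_extU /= linearP.
  by apply: mem_lin_span; left; right; exists c, (f v1), (g w1), (g w2).
- rewrite linearB /= !lin_extU /= fS gS.
  by apply: mem_lin_span; right; exists (f v1), s, (g w1).
Qed.

End TensorMap.

Section InducedModule.
Variables (F : fieldType) (L : lieAlgType F) (S : set L).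

Local Notation P := (lie_sub S).

Lemma uea_incl_proof (x y : P) : uea_in (val (lie x y)) =
  uea_in (val x) * uea_in (val y) - uea_in (val y) * uea_in (val x).
Proof. exact: uea_inE. Qed.

Definition uea_incl_fun (x : P) : uea L := uea_in (val x).

Lemma uea_incl_linear : linear uea_incl_fun.
Proof. by move=> c x y; rewrite /uea_incl_fun !linearP. Qed.

HB.instance Definition _ := GRing.isLinear.Build F P (uea L) *:%R
  uea_incl_fun uea_incl_linear.

Definition uea_incl : lie_hom P (uea L) :=
  @LieHom F P (uea L) uea_incl_fun uea_incl_proof.

Variable psi : lie_hom P F^o.

(* C_psi is F^o with s in U(P) acting as multiplication by psi(s) *)
Definition uea_ract (u : uea L) (s : uea P) : uea L := u * uea_lift uea_incl s.
Definition char_lact (s : uea P) (c : F^o) : F^o := uea_lift psi s * c.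

(* U(L) (x)_{U(P)} C_psi *)
Definition induced := tensor uea_ract char_lact.
HB.instance Definition _ := GRing.Lmodule.on induced.

Definition induced_act (x : L) : induced -> induced :=
  tensor_map uea_ract char_lact (fun u : uea L => uea_in x * u) id.

Lemma induced_actE x u c :
  induced_act x (pure_tensor uea_ract char_lact u c) =
  pure_tensor uea_ract char_lact (uea_in x * u) c.
Proof.
pose f : {linear uea L -> uea L} := (uea_in x \*o (idfun : uea L -> uea L)).
by apply: (@tensor_mapE _ _ _ _ _ _ _ _ _ _ f idfun) => // v s; exact: mulrA.
Qed.

End InducedModule.

Section Modules.
Variables (F : fieldType) (L : lieAlgType F).

Definition lie_module (V : lmodType F) (act : L -> V -> V) : Prop :=
  [/\ forall v, linear (act^~ v), forall x, linear (act x) &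
      forall x y v, act (lie x y) v = act x (act y v) - act y (act x v)].

Definition simple_module (V : lmodType F) (act : L -> V -> V) : Prop :=
  (exists v : V, v <> 0) /\
  forall W : {pred V}, submod_closed W ->
    (forall x v, v \in W -> act x v \in W) ->
    (forall v, v \in W -> v = 0) \/ (forall v, v \in W).

Definition quotient_module (V W : lmodType F)
    (actV : L -> V -> V) (actW : L -> W -> W) : Prop :=
  exists f : {linear V -> W},
    (forall w, exists v, f v = w) /\ forall x v, f (actV x v) = actW x (f v).

End Modules.

Variant sl2_idx := Idx_e | Idx_f | Idx_h.

Definition sl2_idx_code (x : sl2_idx) : option bool :=
  match x with Idx_e => Some true | Idx_f => Some false | Idx_h => None end.
Definition sl2_idx_decode (b : option bool) : sl2_idx :=
  match b with Some true => Idx_e | Some false => Idx_f | None => Idx_h end.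
Lemma sl2_idx_codeK : cancel sl2_idx_code sl2_idx_decode.
Proof. by case. Qed.

HB.instance Definition _ := Countable.copy sl2_idx (can_type sl2_idx_codeK).

Section AffineSl2.
Variable F : fieldType.

Definition sl2 := {malg F[sl2_idx]}.
HB.instance Definition _ := GRing.Lmodule.on sl2.

Definition sl2_bracket (x y : sl2_idx) : sl2 :=
  match x, y with
  | Idx_e, Idx_f => << Idx_h >>
  | Idx_f, Idx_e => - << Idx_h >>
  | Idx_h, Idx_e => 2 *: << Idx_e >>
  | Idx_e, Idx_h => - (2 *: << Idx_e >>)
  | Idx_h, Idx_f => - (2 *: << Idx_f >>)
  | Idx_f, Idx_h => 2 *: << Idx_f >>
  | _, _ => 0
  end.

Definition sl2_form (x y : sl2_idx) : F :=
  match x, y with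
  | Idx_e, Idx_f | Idx_f, Idx_e => 1
  | Idx_h, Idx_h => 2
  | _, _ => 0
  end.

(* basis of the affine algebra: x(n) is [Some (x, n)] and K is [None] *)
Definition hat_idx := option (sl2_idx * int)%type.
HB.instance Definition _ := Countable.on hat_idx.

Definition sl2hat := {malg F[hat_idx]}.
HB.instance Definition _ := GRing.Lmodule.on sl2hat.

Definition hat_K : sl2hat := << None >>.

Definition loop (x : sl2) (n : int) : sl2hat :=
  lin_ext (fun i : sl2_idx => << (Some (i, n) : hat_idx) >> : sl2hat) x.

Definition hat_e (n : int) : sl2hat := loop << Idx_e >> n.
Definition hat_f (n : int) : sl2hat := loop << Idx_f >> n.
Definition hat_h (n : int) : sl2hat := loop << Idx_h >> n.

Definition hat_bracket_idx (i j : hat_idx) : sl2hat :=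
  match i, j with
  | Some (x, n), Some (y, m) =>
      loop (sl2_bracket x y) (n + m) +
      (if n + m == 0 then n%:~R * sl2_form x y else 0) *: hat_K
  | _, _ => 0
  end.

(* bilinear extension of [hat_bracket_idx], locked to keep conversion tractable *)
Definition hat_bracket : sl2hat -> sl2hat -> sl2hat :=
  locked (fun x y => lin_ext (fun i => lin_ext (hat_bracket_idx i) y) x).

Lemma hat_bracketE x y :
  hat_bracket x y = lin_ext (fun i => lin_ext (hat_bracket_idx i) y) x.
Proof. by rewrite /hat_bracket -lock. Qed.

Lemma hat_bracket_linearl z : linear (hat_bracket^~ z).
Proof. by move=> c x y; rewrite !hat_bracketE lin_ext_linear. Qed.

Lemma hat_bracket_linearr z : linear (hat_bracket z).
Proof.
move=> c x y; rewrite !hat_bracketE [LHS]/lin_ext [in RHS]/lin_ext.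
rewrite scaler_sumr -big_split /=; apply: eq_bigr => i _.
rewrite -/(lin_ext _ _) -/(lin_ext _ x) -/(lin_ext _ y).
by rewrite lin_ext_linear scalerDr !scalerA mulrC.
Qed.

HB.instance Definition _ z := GRing.isLinear.Build F sl2hat sl2hat *:%R
  (hat_bracket z) (hat_bracket_linearr z).

Lemma hat_bracket0l z : hat_bracket 0 z = 0.
Proof. by rewrite hat_bracketE linear0. Qed.

Lemma hat_bracketU i j : hat_bracket << i >> << j >> = hat_bracket_idx i j.
Proof. by rewrite hat_bracketE !lin_extU. Qed.

Lemma hat_basis_ind (P : sl2hat -> Prop) :
  P 0 -> (forall c x y, P x -> P y -> P (c *: x + y)) ->
  (forall i, P << i >>) -> forall x, P x.
Proof.
move=> P0 PD PU x; rewrite (monalgE x).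
elim: (enum_fset _) => [|i s IHs]; first by rewrite big_nil.
rewrite big_cons; have -> : << x@_i *g i >> = x@_i *: << i >> :> sl2hat.
  by apply/malgP => k; rewrite mcoeffZ !mcoeffU mulrnAr mulr1.
exact: PD.
Qed.

Lemma hat_bracket_idxC i j : hat_bracket_idx i j = - hat_bracket_idx j i.
Proof.
case: i j => [[x n]|] [[y m]|] /=; rewrite ?oppr0 // opprD [m + n]addrC -scaleNr.
congr (_ + _ *: _); first by case: x y => [] []; rewrite /= /loop ?linearN ?opprK ?linear0 ?oppr0.
case: eqP => [nm|_]; last by rewrite oppr0.
have -> : m = - n by apply/eqP; rewrite -addr_eq0 addrC nm.
by rewrite mulrNz mulNr opprK; case: x y => [] [].
Qed.

Lemma hat_bracketC x y : hat_bracket x y = - hat_bracket y x.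
Proof.
elim/hat_basis_ind: x => [|c u v IHu IHv|i].
- by rewrite linear0 hat_bracket0l oppr0.
- by rewrite linearP hat_bracket_linearl /= IHu IHv scalerN opprD.
elim/hat_basis_ind: y => [|c u v IHu IHv|j].
- by rewrite linear0 hat_bracket0l oppr0.
- by rewrite linearP hat_bracket_linearl /= IHu IHv scalerN opprD.
by rewrite !hat_bracketU hat_bracket_idxC.
Qed.

Lemma hat_bracketxx x : hat_bracket x x = 0.
Proof.
elim/hat_basis_ind: x => [|c u v IHu IHv|i]; first exact: linear0.
  rewrite linearP /= !hat_bracket_linearl /=.
  by rewrite IHu IHv scaler0 add0r addr0 hat_bracketC scalerN addNr.
rewrite hat_bracketU; case: i => [[x n]|] //=.
have -> : sl2_bracket x x = 0 by case: x.
rewrite /loop linear0 add0r; case: eqP => [nn|_]; last by rewrite scale0r.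
have -> : n = 0 by apply/eqP; move/eqP: nn; rewrite -mulr2n -mulr_natl mulf_eq0.
by rewrite mul0r scale0r.
Qed.

Lemma hat_bracketKl x : hat_bracket << None >> x = 0.
Proof.
elim/hat_basis_ind: x => [|c u v IHu IHv|i]; first exact: linear0.
  by rewrite linearP /= IHu IHv scaler0 addr0.
by rewrite hat_bracketU.
Qed.

Lemma hat_bracketKr x : hat_bracket x << None >> = 0.
Proof. by rewrite hat_bracketC hat_bracketKl oppr0. Qed.

Let ad (x : sl2_idx) : sl2 -> sl2 := lin_ext (sl2_bracket x).
Let formr (x : sl2_idx) : sl2 -> F^o := lin_ext (sl2_form x : sl2_idx -> F^o).

Lemma sl2_adU x y : ad x << y >> = sl2_bracket x y.
Proof. exact: lin_extU. Qed.

Lemma sl2_formrU x y : formr x << y >> = sl2_form x y.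
Proof. exact: lin_extU. Qed.

Lemma sl2_jacobi x y z : ad x (sl2_bracket y z) + ad y (sl2_bracket z x) +
  ad z (sl2_bracket x y) = 0.
Proof.
have adN u g : ad u (- g) = - ad u g by exact: linearN.
have adZ u c g : ad u (c *: g) = c *: ad u g by exact: linearZ.
have ad0 u : ad u 0 = 0 by exact: linear0.
case: x y z => [] [] [] /=; rewrite ?adN ?adZ ?ad0 ?sl2_adU /=;
  by rewrite ?(scaler0, oppr0, addr0, add0r, opprK, scalerN) ?(addrN, addNr).
Qed.

Lemma sl2_form_inv x y z :
  formr x (sl2_bracket y z) = formr y (sl2_bracket z x).
Proof.
have fN u g : formr u (- g) = - formr u g by exact: linearN.
have fZ u c g : formr u (c *: g) = c * formr u g by exact: linearZ.
have f0 u : formr u 0 = 0 by exact: linear0.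
by case: x y z => [] [] [] /=; rewrite ?fN ?fZ ?f0 ?sl2_formrU /= ?(mulr1, mulr0, oppr0).
Qed.

Lemma hat_bracket_loop x n g m : hat_bracket << Some (x, n) >> (loop g m) =
  loop (ad x g) (n + m) +
  (if n + m == 0 then n%:~R * formr x g else 0) *: hat_K.
Proof.
pose K : sl2_idx -> Prop := fun y =>
  hat_bracket << Some (x, n) >> (loop << y >> m) = loop (ad x << y >>) (n + m) +
  (if n + m == 0 then n%:~R * formr x << y >> else 0) *: hat_K.
have PK y : K y by rewrite /K /loop lin_extU hat_bracketU /= sl2_adU sl2_formrU.
rewrite (monalgE g); elim: (enum_fset _) => [|i s IHs].
  have loop0 k : loop 0 k = 0 by exact: linear0.
  have ad0 : ad x 0 = 0 by exact: linear0.
  have f0 : formr x 0 = 0 by exact: linear0.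
  by rewrite big_nil ad0 f0 !loop0 linear0 mulr0 if_same scale0r addr0.
rewrite big_cons; have -> : << g@_i *g i >> = g@_i *: << i >> :> sl2.
  by apply/malgP => k; rewrite mcoeffZ !mcoeffU mulrnAr mulr1.
move: (PK i) IHs; rewrite /K; set u : sl2 := << i >>; set v := \sum_(_ <- _) _.
move=> Pu Pv; have loopP c a b k : loop (c *: a + b) k = c *: loop a k + loop b k.
  exact: linearP.
have adP : ad x (g@_i *: u + v) = g@_i *: ad x u + ad x v by exact: linearP.
have fP : formr x (g@_i *: u + v) = g@_i * formr x u + formr x v by exact: linearP.
rewrite loopP linearP /= Pu Pv adP fP loopP scalerDr addrACA; congr (_ + _).
rewrite scalerA -scalerDl; congr (_ *: _); case: ifP => _; last by rewrite mulr0 addr0.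
by rewrite mulrDr mulrCA.
Qed.

Lemma hat_bracket_idx3 x n y m z k N : n + (m + k) = N ->
  hat_bracket << Some (x, n) >> (hat_bracket_idx (Some (y, m)) (Some (z, k))) =
  loop (ad x (sl2_bracket y z)) N +
  (if N == 0 then n%:~R * formr x (sl2_bracket y z) else 0) *: hat_K.
Proof.
move=> <-; rewrite /hat_bracket_idx linearD linearZ /=.
by rewrite hat_bracketKr scaler0 addr0 hat_bracket_loop.
Qed.

Lemma hat_jacobiU i j k :
  hat_bracket << i >> (hat_bracket << j >> << k >>) +
  hat_bracket << j >> (hat_bracket << k >> << i >>) +
  hat_bracket << k >> (hat_bracket << i >> << j >>) = 0.
Proof.
case: i j k => [[x n]|] [[y m]|] [[z k]|];
  rewrite ?hat_bracketKl ?hat_bracketKr ?linear0 ?hat_bracketKr ?addr0 //.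
rewrite !hat_bracketU; set N := n + (m + k).
have N2 : m + (k + n) = N by rewrite /N addrA [RHS]addrC.
have N3 : k + (n + m) = N by rewrite /N addrC addrA.
apply: (etrans (f_equal2 +%R (f_equal2 +%R
  (hat_bracket_idx3 x y z (erefl N)) (hat_bracket_idx3 y z x N2))
  (hat_bracket_idx3 z x y N3))).
rewrite -(sl2_form_inv z x y) -(sl2_form_inv y z x).
move: (sl2_jacobi x y z); set a := ad x _; set b := ad y _; set c := ad z _ => abc.
move: (formr _ _) => t.
have loopD u v l : loop (u + v) l = loop u l + loop v l by exact: linearD.
have loop0 l : loop 0 l = 0 by exact: linear0.
rewrite [X in X + _]addrACA -loopD -scalerDl addrACA -loopD abc loop0 add0r -scalerDl.
case: eqP => [N0|_]; last by rewrite !addr0 scale0r.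
by rewrite -!mulrDl -!intrD -addrA -/N N0 mul0r scale0r.
Qed.

Lemma hat_jacobi x y z : hat_bracket x (hat_bracket y z) +
  hat_bracket y (hat_bracket z x) + hat_bracket z (hat_bracket x y) = 0.
Proof.
have comb (c : F) (a b d a' b' d' : sl2hat) : a + b + d = 0 -> a' + b' + d' = 0 ->
    (c *: a + a') + (c *: b + b') + (c *: d + d') = 0.
  move=> E E'; have -> : (c *: a + a') + (c *: b + b') = c *: (a + b) + (a' + b').
    by rewrite addrACA scalerDr.
  by rewrite addrACA E' addr0 -scalerDr E scaler0.
elim/hat_basis_ind: x => [|c u v IHu IHv|i].
- by rewrite !(hat_bracket0l, linear0) /= ?(hat_bracket0l, linear0) !addr0.
- rewrite 3?(linearP, hat_bracket_linearl) /= ?(linearP, hat_bracket_linearl) /=.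
  by rewrite ?(linearP, hat_bracket_linearl) /= comb.
elim/hat_basis_ind: y => [|c u v IHu IHv|j].
- by rewrite !(hat_bracket0l, linear0) /= ?(hat_bracket0l, linear0) !addr0.
- rewrite 3?(linearP, hat_bracket_linearl) /= ?(linearP, hat_bracket_linearl) /=.
  by rewrite ?(linearP, hat_bracket_linearl) /= comb.
elim/hat_basis_ind: z => [|c u v IHu IHv|k].
- by rewrite !(hat_bracket0l, linear0) /= ?(hat_bracket0l, linear0) !addr0.
- rewrite 3?(linearP, hat_bracket_linearl) /= ?(linearP, hat_bracket_linearl) /=.
  by rewrite ?(linearP, hat_bracket_linearl) /= comb.
exact: hat_jacobiU.
Qed.

HB.instance Definition _ := Lmodule_isLieAlgebra.Build F sl2hat
  hat_bracket_linearl hat_bracket_linearr hat_bracketxx hat_jacobi.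

End AffineSl2.

Section WhittakerSubalgebra.
Variables (F : fieldType) (q r : nat).

Definition whit_gens : set (sl2hat F) :=
  [set x | x = hat_K F] `|`
  [set x | exists n : nat, x = hat_e F n%:Z] `|`
  [set x | exists m : nat, (q <= m)%N /\ x = hat_h F m%:Z] `|`
  [set x | exists p : nat, (r <= p)%N /\ x = hat_f F p%:Z].

Definition whit_alg := lie_sub whit_gens.
HB.instance Definition _ := LieAlgebra.on whit_alg.

Lemma whit_K_gen : whit_gens (hat_K F).
Proof. by left; left; left. Qed.
Lemma whit_e_gen (i : nat) : whit_gens (hat_e F i%:Z).
Proof. by left; left; right; exists i. Qed.
Lemma whit_h_gen (i : nat) : whit_gens (hat_h F (q + i)%N%:Z).
Proof. by left; right; exists (q + i)%N; rewrite leq_addr. Qed.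
Lemma whit_f_gen (i : nat) : whit_gens (hat_f F (r + i)%N%:Z).
Proof. by right; exists (r + i)%N; rewrite leq_addr. Qed.

(* K, e(i), h(q + i) and f(r + i) as elements of the subalgebra *)
Definition whit_K : whit_alg := LieSub (mem_lie_span whit_K_gen).
Definition whit_e (i : nat) : whit_alg := LieSub (mem_lie_span (whit_e_gen i)).
Definition whit_h (i : nat) : whit_alg := LieSub (mem_lie_span (whit_h_gen i)).
Definition whit_f (i : nat) : whit_alg := LieSub (mem_lie_span (whit_f_gen i)).

Definition whittaker (psi : lie_hom whit_alg F^o) := induced psi.
HB.instance Definition _ psi := GRing.Lmodule.on (whittaker psi).

Definition whittaker_act (psi : lie_hom whit_alg F^o) :
  sl2hat F -> whittaker psi -> whittaker psi := @induced_act _ _ _ psi.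

End WhittakerSubalgebra.

(* [inl n] stands for a(n) and [inr n] for a^*(n) *)
Definition weyl_idx := (int + int)%type.
HB.instance Definition _ := Countable.on weyl_idx.

(* the annihilators a(n), n >= 0, and a^*(n), n >= 1, of the vacuum *)
Definition annihilator (x : weyl_idx) : bool :=
  match x with inl n => (0 <= n)%R | inr n => (1 <= n)%R end.

Definition normal_order (s : seq weyl_idx) : seq weyl_idx :=
  filter (predC annihilator) s ++ filter annihilator s.

Section WeylAlgebra.
Variable F : fieldType.

Definition weyl_form (x y : weyl_idx) : F :=
  match x, y with
  | inl n, inr m => (n + m == 0)%:R
  | inr n, inl m => - (n + m == 0)%:R
  | _, _ => 0
  end.

Local Notation gen := (@free_gen F weyl_idx).

Definition weyl_rels : set (free_alg F weyl_idx) :=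
  [set t | exists x y, t = gen x * gen y - gen y * gen x - (weyl_form x y)%:A].

Definition weyl := quot_alg weyl_rels.
HB.instance Definition _ := GRing.PzRing.on weyl.
HB.instance Definition _ := GRing.Lmodule.on weyl.

Definition weyl_gen (x : weyl_idx) : weyl := quot_alg_proj weyl_rels (gen x).

Lemma weyl_genC x y : weyl_gen x * weyl_gen y - weyl_gen y * weyl_gen x =
  weyl_form x y *: (1 : weyl) :> weyl.
Proof.
rewrite /weyl_gen -!rmorphM -rmorphB -[1](rmorph1 (quot_alg_proj weyl_rels)).
rewrite -linearZ; apply/quot_projP/mem_lin_span.
exists 1, (gen x * gen y - gen y * gen x - (weyl_form x y)%:A), 1.
by split; [exists x, y|rewrite mul1r mulr1].
Qed.

Definition left_ideal_gens (S : set weyl) : set weyl :=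
  [set x | exists y s, S s /\ x = y * s].

Section WhittakerModule.
Variables lam mu : nat -> F.

Definition M1_gens : set weyl :=
  [set s | exists i : nat, s = weyl_gen (inl i%:Z) - lam i *: (1 : weyl)] `|`
  [set s | exists j : nat, (1 <= j)%N /\ s = weyl_gen (inr j%:Z) - mu j *: (1 : weyl)].

Definition M1 := quot_space (left_ideal_gens M1_gens).
HB.instance Definition _ := GRing.Lmodule.on M1.

Definition M1_proj (y : weyl) : M1 := quot_proj (left_ideal_gens M1_gens) y.

Definition M1_act (x : weyl) : M1 -> M1 :=
  quot_map (left_ideal_gens M1_gens) (fun y => x * y).

Lemma M1_actE x y : M1_act x (M1_proj y) = M1_proj (x * y).
Proof.
have mul_linear : linear (fun y : weyl => x * y).
  by move=> c u v /=; rewrite mulrDr quot_scaleAr.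
pose f : {linear weyl -> weyl} := HB.pack (fun y : weyl => x * y)
  (GRing.isLinear.Build F weyl weyl *:%R _ mul_linear).
apply: (@quot_mapE _ _ _ _ _ f) => _ [u [s [Ss ->]]].
by apply: mem_lin_span; exists (x * u), s; rewrite /= mulrA.
Qed.

End WhittakerModule.
End WeylAlgebra.

Section Heisenberg.
Variables (F : fieldType) (chi : int -> F).

(* L(chi): the one-dimensional space F^o with b(n) acting by chi_n *)
Definition Lchi_act (n : int) (v : F^o) : F^o := chi n * v.

End Heisenberg.

Section Wakimoto.
Variables (F : fieldType) (V : lmodType F).
Variables (a a' b : int -> V -> V).

Definition mode (x : weyl_idx) : V -> V :=
  match x with inl n => a n | inr n => a' n end.

Definition normal_product (s : seq weyl_idx) (v : V) : V :=
  foldr mode v (normal_order s).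

(* Coefficients of z^(-n-1) in the three fields. The sums over [setT] are sums
   of finitely supported families when V is smooth for a, a^* and b, as
   M_1(lambda, mu) (x) L(chi) is (a sum with infinite support would be 0). *)
Definition wakimoto_e (n : int) (v : V) : V := a n v.

Definition wakimoto_h (n : int) (v : V) : V :=
  (-2) *: (\sum_(k \in [set: int]) normal_product [:: inr k; inl (n - k)] v)
  + b n v.

(* -2 (d/dz) a^*(z) contributes 2 n a^*(n) *)
Definition wakimoto_f (n : int) (v : V) : V :=
  - (\sum_(k \in [set: int * int])
       normal_product [:: inr k.1; inr k.2; inl (n - k.1 - k.2)] v)
  + (2 * n%:~R) *: a' n v
  + \sum_(k \in [set: int]) a' k (b (n - k) v).

Definition wakimoto_act (x : sl2hat F) (v : V) : V :=
  lin_ext (fun i : hat_idx =>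
    match i with
    | Some (Idx_e, n) => wakimoto_e n v
    | Some (Idx_h, n) => wakimoto_h n v
    | Some (Idx_f, n) => wakimoto_f n v
    | None => (-2) *: v
    end) x.

End Wakimoto.

(* V^k(sl_2)-modules, as smooth modules over the affine algebra of level k *)
Definition affine_vertex_module (F : fieldType) (k : F) (V : lmodType F)
    (act : sl2hat F -> V -> V) : Prop :=
  [/\ lie_module act,
      forall (v : V) (x : sl2 F), exists N : int,
        forall n : int, N <= n -> act (loop x n) v = 0 &
      forall v : V, act (hat_K F) v = k *: v].

Section WakimotoModule.
Variables (F : fieldType) (lam mu : nat -> F) (chi : int -> F).

Definition scalar_ract (v : M1 lam mu) (c : F) : M1 lam mu := c *: v.
Definition scalar_lact (c : F) (w : F^o) : F^o := c *: w.

Definition M1L := tensor scalar_ract scalar_lact.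
HB.instance Definition _ := GRing.Lmodule.on M1L.

Definition M1L_weyl (x : weyl_idx) : M1L -> M1L :=
  tensor_map scalar_ract scalar_lact (M1_act (weyl_gen F x)) id.

Definition M1L_heis (n : int) : M1L -> M1L :=
  tensor_map scalar_ract scalar_lact id (Lchi_act chi n).

Definition M1L_act : sl2hat F -> M1L -> M1L :=
  wakimoto_act (fun n => M1L_weyl (inl n)) (fun n => M1L_weyl (inr n)) M1L_heis.

End WakimotoModule.

(* Main.v *)
Require Import Defs.
From HB Require Import structures.
From mathcomp Require Import all_boot all_order all_algebra.
From mathcomp Require Import finmap.
From mathcomp Require Import boolp classical_sets functions cardinality fsbigop.
From mathcomp Require Import reals complex.
From mathcomp Require Import monalg.
From mathcomp Require Import zify ring.

(* Work with the operators a(n), a^*(n), b(n) on a smooth module over the Weyl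
   algebra.  Their commutators with the Wakimoto fields e(n), h(n), f(n) are
   immediate, and [h(n), h(m)] comes from reordering a quadratic expression.
   Then [h(n), f(m)] + 2 f(n+m) and [f(n), f(m)] commute with the whole Weyl
   algebra, hence with h(0); but they have weight -2 and -4 for h(0), so they
   vanish.  This gives the module structure.

   For simplicity, let W be a submodule.  It is stable under a(n) = e(n).  Since
   lam_N <> 0, the operator h(m+N) recovers a^*(m) w from the a^*(k) w with k > m
   and from vectors on which the a(n) - lam_n act with smaller nilpotency order,
   so W is stable under the Weyl algebra.  The Weyl module M_1(lam, mu) is simple:
   a nonzero submodule contains a vector annihilated by all a(n) - lam_n and
   a^*(n) - mu_n, and the Euler operator shows that such a vector is a multiple of
   the generator.

   The generator is an eigenvector of the subalgebra P_{q,r} with the prescribed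
   eigenvalues, so it induces a homomorphism from the universal Whittaker module,
   which is onto by simplicity. *)

Set Implicit Arguments.
Unset Strict Implicit.
Unset Printing Implicit Defensive.

Import Order.TTheory GRing.Theory Num.Theory.

Local Open Scope ring_scope.

(** * Linear operators and their commutators *)

Section Endomorphisms.
Variables (F : fieldType) (V : lmodType F).

(** The modes of the Wakimoto fields are infinite sums that make sense only vector by vector, and
    without normal ordering they need not be locally finite. Expanding [[f(n), f(m)]], a bracket of
    two cubic sums, would require many reorderings. The detour through the centralizer of the Weyl
    algebra leaves a single one, in [comm_H_J], where a finite count produces the central term. It
    works because [b(n)] acts by the scalar [chi n]: [h(0)] is then a locally finite sum of Weyl
    products plus a scalar.

    The subalgebra P_{q,r} is never described explicitly. Brackets act by zero on a common
    eigenvector of the generators, so the eigenvalues form a character as soon as that vector is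
    nonzero; this gives the existence of [psi]. Since M_1(lambda, mu) is defined by generators and
    relations, the nonvanishing is read off from a model, a Fock space with shifted annihilators.
    The bounds in q and r are those under which the terms of [h(n)] and [f(n)] that do not kill the
    generator are products of annihilators, up to the scalars from [b]. *)

Record endo := Endo { endo_fun :> V -> V; endo_linear : linear endo_fun }.

HB.instance Definition _ (x : endo) :=
  GRing.isLinear.Build F V V *:%R (endo_fun x) (endo_linear x).
HB.instance Definition _ := gen_eqMixin endo.
HB.instance Definition _ := gen_choiceMixin endo.

Lemma endoP (x y : endo) : (forall v, x v = y v) -> x = y.
Proof.
case: x y => f fl [g gl] /= /funext fg; subst g; congr Endo; exact: Prop_irrelevance.
Qed.

Lemma endo_zero_linear : linear (fun _ : V => 0 : V).
Proof. by move=> c u v; rewrite scaler0 addr0. Qed.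
Lemma endo_opp_linear (x : endo) : linear (fun v => - x v).
Proof. by move=> c u v; rewrite linearP opprD scalerN. Qed.
Lemma endo_add_linear (x y : endo) : linear (fun v => x v + y v).
Proof. by move=> c u v; rewrite !linearP addrACA scalerDr. Qed.
Lemma endo_id_linear : linear (fun v : V => v).
Proof. by []. Qed.
Lemma endo_mul_linear (x y : endo) : linear (fun v => x (y v)).
Proof. by move=> c u v; rewrite !linearP. Qed.
Lemma endo_scale_linear c (x : endo) : linear (fun v => c *: x v).
Proof. by move=> d u v; rewrite linearP scalerDr !scalerA mulrC. Qed.

Definition endo_zero := Endo endo_zero_linear.
Definition endo_opp x := Endo (endo_opp_linear x).
Definition endo_add x y := Endo (endo_add_linear x y).
Definition endo_one := Endo endo_id_linear.
Definition endo_mul x y := Endo (endo_mul_linear x y).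
Definition endo_scale c x := Endo (endo_scale_linear c x).

Lemma endo_addA : associative endo_add.
Proof. by move=> x y z; apply: endoP => v /=; rewrite addrA. Qed.
Lemma endo_addC : commutative endo_add.
Proof. by move=> x y; apply: endoP => v /=; rewrite addrC. Qed.
Lemma endo_add0 : left_id endo_zero endo_add.
Proof. by move=> x; apply: endoP => v /=; rewrite add0r. Qed.
Lemma endo_addN : left_inverse endo_zero endo_opp endo_add.
Proof. by move=> x; apply: endoP => v /=; rewrite addNr. Qed.

HB.instance Definition _ := GRing.isZmodule.Build endo
  endo_addA endo_addC endo_add0 endo_addN.

Lemma endo_mulA : associative endo_mul.
Proof. by move=> x y z; apply: endoP. Qed.
Lemma endo_mul1 : left_id endo_one endo_mul.
Proof. by move=> x; apply: endoP. Qed.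
Lemma endo_mulr1 : right_id endo_one endo_mul.
Proof. by move=> x; apply: endoP. Qed.
Lemma endo_mulDl : left_distributive endo_mul +%R.
Proof. by move=> x y z; apply: endoP. Qed.
Lemma endo_mulDr : right_distributive endo_mul +%R.
Proof. by move=> x y z; apply: endoP => v /=; rewrite linearD. Qed.

(** [V] may be zero, so 1 = 0 is allowed here; [endo_alg] below adds the nonvanishing. *)
HB.instance Definition _ := GRing.Zmodule_isPzRing.Build endo
  endo_mulA endo_mul1 endo_mulr1 endo_mulDl endo_mulDr.

Lemma endo_scaleA a b x : endo_scale a (endo_scale b x) = endo_scale (a * b) x.
Proof. by apply: endoP => v /=; rewrite scalerA. Qed.
Lemma endo_scale1 : left_id 1 endo_scale.
Proof. by move=> x; apply: endoP => v /=; rewrite scale1r. Qed.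
Lemma endo_scaleDr : right_distributive endo_scale +%R.
Proof. by move=> c x y; apply: endoP => v /=; rewrite scalerDr. Qed.
Lemma endo_scaleDl x : {morph endo_scale^~ x : a b / a + b}.
Proof. by move=> a b; apply: endoP => v /=; rewrite scalerDl. Qed.

HB.instance Definition _ := GRing.Zmodule_isLmodule.Build F endo
  endo_scaleA endo_scale1 endo_scaleDr endo_scaleDl.

Lemma endo0E v : (0 : endo) v = 0. Proof. by []. Qed.
Lemma endo1E v : (1 : endo) v = v. Proof. by []. Qed.
Lemma endoDE (x y : endo) v : (x + y) v = x v + y v. Proof. by []. Qed.
Lemma endoNE (x : endo) v : (- x) v = - x v. Proof. by []. Qed.
Lemma endoME (x y : endo) v : (x * y) v = x (y v). Proof. by []. Qed.
Lemma endoZE c (x : endo) v : (c *: x) v = c *: x v. Proof. by []. Qed.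
Definition endoE := (endo0E, endo1E, endoDE, endoNE, endoME, endoZE).

Lemma endo_scaleAl c (x y : endo) : c *: (x * y) = (c *: x) * y.
Proof. by apply: endoP. Qed.
Lemma endo_scaleAr c (x y : endo) : c *: (x * y) = x * (c *: y).
Proof. by apply: endoP => v; rewrite !endoE linearZ. Qed.

Definition comm (x y : endo) : endo := x * y - y * x.

Lemma comm_linear x : linear (comm x).
Proof.
move=> c y z; rewrite /comm mulrDr mulrDl -endo_scaleAr -endo_scaleAl opprD.
by rewrite addrACA -scalerBr.
Qed.
HB.instance Definition _ x :=
  GRing.isLinear.Build F endo endo *:%R (comm x) (comm_linear x).

Lemma commC x y : comm x y = - comm y x.
Proof. by rewrite /comm opprB. Qed.

Lemma commM x y z : comm x (y * z) = comm x y * z + y * comm x z.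
Proof. by rewrite /comm mulrBl mulrBr !mulrA subrKA. Qed.

(** The Jacobi identity as a derivation rule: it reduces the commutator of a Weyl generator with a
    bracket of Wakimoto operators to simpler brackets. *)
Lemma comm_comm x y z : comm x (comm y z) = comm (comm x y) z + comm y (comm x z).
Proof.
have E (a b c d : endo) : a + b - (c + d) = (a - d) + (b - c).
  by rewrite [c + d]addrC opprD addrACA.
by rewrite {2}/comm linearB /= !commM E.
Qed.

Lemma comm1 x (c : F) : comm x (c *: (1 : endo)) = 0.
Proof. by rewrite linearZ /= /comm mulr1 mul1r subrr scaler0. Qed.

Lemma commxx x : comm x x = 0. Proof. exact: subrr. Qed.

Lemma mulCcomm x y : x * y = y * x + comm x y.
Proof. by rewrite /comm addrC subrK. Qed.

End Endomorphisms.

(** * Locally finite sums of operators *)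

Section LocallyFiniteSums.
Variables (F : fieldType) (V : lmodType F).
Implicit Types I J : choiceType.

Definition locfin I (T : I -> endo V) : Prop :=
  forall v, exists A : {fset I}, forall i, i \notin A -> T i v = 0.

(** A pointwise sum with infinite support is 0 by convention, so linearity can fail without
    [locfin]; with it, one finite set serves for [u], [v] and [c *: u + v]. *)
Lemma lsum_linear I (T : I -> endo V) : locfin T ->
  linear (fun v => \sum_(i \in [set: I]%classic) T i v).
Proof.
move=> lfT c u v; have [A HA] := lfT u; have [B HB] := lfT v.
have [C HC] := lfT (c *: u + v).
pose D := (A `|` B `|` C)%fset.
have HD w (E : {fset I}) : (E `<=` D)%fset -> (forall i, i \notin E -> T i w = 0) ->
    \sum_(i \in [set: I]%classic) T i w = \sum_(i <- D) T i w.
  by move=> /fsubsetP ED HE; apply: fsbigTE => i iD; apply/HE/(contra (ED i)).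
have AD : (A `<=` D)%fset by rewrite /D -fsetUA fsubsetUl.
have BD : (B `<=` D)%fset := fsubset_trans (fsubsetUr A B) (fsubsetUl _ _).
rewrite (HD _ C (fsubsetUr _ _) HC) (HD u A AD HA) (HD v B BD HB).
by rewrite scaler_sumr -big_split; apply: eq_bigr => i _; rewrite linearP.
Qed.

(* 0 when the family is not locally finite *)
Definition lsum I (T : I -> endo V) : endo V :=
  if pselect (locfin T) is left lfT then Endo (lsum_linear lfT) else 0.

Lemma lsumE I (T : I -> endo V) v : locfin T ->
  lsum T v = \sum_(i \in [set: I]%classic) T i v.
Proof. by move=> lfT; rewrite /lsum; case: pselect. Qed.

Lemma lsum_fset I (T : I -> endo V) v (A : {fset I}) : locfin T ->
  (forall i, i \notin A -> T i v = 0) -> lsum T v = \sum_(i <- A) T i v.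
Proof. by move=> lfT HA; rewrite lsumE //; apply: fsbigTE. Qed.

Lemma eq_lsum I (T U : I -> endo V) : (forall i, T i = U i) -> lsum T = lsum U.
Proof. by move=> /funext ->. Qed.

Lemma locfin_fset2 I (T U : I -> endo V) u v : locfin T -> locfin U ->
  exists A : {fset I}, (forall i, i \notin A -> T i u = 0) /\
    (forall i, i \notin A -> U i v = 0).
Proof.
move=> /(_ u) [A HA] /(_ v) [B HB]; exists (A `|` B)%fset.
by split=> i; rewrite inE negb_or => /andP [? ?]; [apply: HA|apply: HB].
Qed.

Lemma locfinD I (T U : I -> endo V) :
  locfin T -> locfin U -> locfin (fun i => T i + U i).
Proof.
move=> lT lU v; have [A [HT HU]] := locfin_fset2 v v lT lU.
by exists A => i iA; rewrite !endoE HT // HU // addr0.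
Qed.

Lemma locfinZ I (T : I -> endo V) c : locfin T -> locfin (fun i => c *: T i).
Proof. by move=> lT v; have [A HT] := lT v; exists A => i iA; rewrite endoE HT // scaler0. Qed.

Lemma locfinMl I (T : I -> endo V) x : locfin T -> locfin (fun i => x * T i).
Proof. by move=> lT v; have [A HT] := lT v; exists A => i iA; rewrite endoE HT // linear0. Qed.

Lemma locfinMr I (T : I -> endo V) x : locfin T -> locfin (fun i => T i * x).
Proof. by move=> lT v; have [A HT] := lT (x v); exists A => i iA; rewrite endoE HT. Qed.

Lemma locfinN I (T : I -> endo V) : locfin T -> locfin (fun i => - T i).
Proof. by move=> lT v; have [A HT] := lT v; exists A => i iA; rewrite endoE HT // oppr0. Qed.

Lemma locfin_comm I (T : I -> endo V) x : locfin T -> locfin (fun i => comm x (T i)).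
Proof. by move=> lT; apply/locfinD/locfinN/locfinMr => //; apply: locfinMl. Qed.

Lemma lsumD I (T U : I -> endo V) : locfin T -> locfin U ->
  lsum (fun i => T i + U i) = lsum T + lsum U.
Proof.
move=> lT lU; apply: endoP => v; have [A [HT HU]] := locfin_fset2 v v lT lU.
rewrite endoE (lsum_fset lT HT) (lsum_fset lU HU) (@lsum_fset _ _ _ A) ?big_split //.
  exact: locfinD.
by move=> i iA; rewrite endoE HT // HU // addr0.
Qed.

Lemma lsumZ I (T : I -> endo V) c : locfin T -> lsum (fun i => c *: T i) = c *: lsum T.
Proof.
move=> lT; apply: endoP => v; have [A HT] := lT v.
rewrite endoE (lsum_fset lT HT) (@lsum_fset _ _ _ A) ?scaler_sumr //.
  exact: locfinZ.
by move=> i iA; rewrite endoE HT // scaler0.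
Qed.

Lemma lsumMl I (T : I -> endo V) x : locfin T -> lsum (fun i => x * T i) = x * lsum T.
Proof.
move=> lT; apply: endoP => v; have [A HT] := lT v.
rewrite endoE (lsum_fset lT HT) (@lsum_fset _ _ _ A) ?linear_sum //.
  exact: locfinMl.
by move=> i iA; rewrite endoE HT // linear0.
Qed.

Lemma lsumMr I (T : I -> endo V) x : locfin T -> lsum (fun i => T i * x) = lsum T * x.
Proof.
move=> lT; apply: endoP => v; have [A HT] := lT (x v).
rewrite endoE (lsum_fset lT HT) (@lsum_fset _ _ _ A) //.
exact: locfinMr.
Qed.

Lemma lsumN I (T : I -> endo V) : locfin T -> lsum (fun i => - T i) = - lsum T.
Proof.
move=> lT; rewrite -scaleN1r -(lsumZ _ lT); apply: eq_lsum => i.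
by rewrite scaleN1r.
Qed.

Lemma comm_lsum I (T : I -> endo V) x : locfin T ->
  comm x (lsum T) = lsum (fun i => comm x (T i)).
Proof.
move=> lT; rewrite /comm -(lsumMl _ lT) -(lsumMr _ lT) -lsumN; last exact: locfinMr.
by rewrite lsumD //; [apply: locfinMl|apply/locfinN/locfinMr].
Qed.

(* Reindexing along an injection [h], with left inverse [g], whose image contains the support. *)
Lemma lsum_inj I J (h : J -> I) (g : I -> J) (T : I -> endo V) : cancel h g ->
  (forall i, h (g i) != i -> T i = 0) -> locfin T ->
  lsum T = lsum (fun j => T (h j)).
Proof.
move=> hK HT lT; apply: endoP => v; have [A HA] := lT v.
pose B := [fset g i | i in A]%fset.
have HB j : j \notin B -> T (h j) v = 0.
  by move=> jB; apply: HA; apply: contra jB => jA; apply/imfsetP; exists (h j).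
have lTh : locfin (fun j => T (h j)).
  move=> w; have [C HC] := lT w; exists [fset g i | i in C]%fset => j jC.
  by apply: HC; apply: contra jC => jC; apply/imfsetP; exists (h j).
rewrite (lsum_fset lTh HB) (@lsum_fset _ _ _ [fset h j | j in B]%fset) //; last first.
  move=> i iB; have [hgi|/HT -> //] := eqVneq (h (g i)) i.
  rewrite -hgi; apply: HB; apply: contra iB => giB.
  by rewrite -hgi; apply/imfsetP; exists (g i).
by rewrite big_imfset //= => j k _ _ /(can_inj hK).
Qed.

Lemma locfin_supp1 I (T : I -> endo V) k : (forall i, i != k -> T i = 0) -> locfin T.
Proof. by move=> HT v; exists [fset k]%fset => i; rewrite inE => /HT ->. Qed.

Lemma lsum_supp1 I (T : I -> endo V) k : (forall i, i != k -> T i = 0) -> lsum T = T k.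
Proof.
move=> HT; apply: endoP => v; rewrite (@lsum_fset _ _ _ [fset k]%fset) ?big_seq_fset1 //.
  exact: locfin_supp1 HT.
by move=> i; rewrite inE => /HT ->.
Qed.

Lemma lsum0 I : lsum (fun _ : I => 0 : endo V) = 0.
Proof.
apply: endoP => v; rewrite (@lsum_fset _ _ _ fset0) ?big_seq_fset0 // => w.
by exists fset0.
Qed.

End LocallyFiniteSums.

Lemma locfin_seq (F : fieldType) (V : lmodType F) (I : choiceType) (T : I -> endo V) :
  (forall v, exists s : seq I, forall i, i \notin s -> T i v = 0) -> locfin T.
Proof.
move=> HT v; have [s Hs] := HT v; exists [fset x in s]%fset => i.
by rewrite inE; exact: Hs.
Qed.

Lemma locfin_int (F : fieldType) (V : lmodType F) (T : int -> endo V) :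
  (forall v, exists B : nat, forall k, (B < absz k)%N -> T k v = 0) -> locfin T.
Proof.
move=> HT; apply: locfin_seq => v; have [B HB] := HT v.
(* These are the integers from [- B] to [B]. *)
exists [seq i%:Z - B%:Z | i <- iota 0 (2 * B).+1] => k kB.
apply: HB; apply: contraR kB; rewrite -leqNgt => kB.
by apply/mapP; exists (absz (k + B%:Z)); rewrite ?mem_iota; lia.
Qed.

Lemma locfin_int2 (F : fieldType) (V : lmodType F) (T : int * int -> endo V) :
  (forall v, exists B : nat, forall k,
    (B < absz k.1)%N || (B < absz k.2)%N -> T k v = 0) -> locfin T.
Proof.
move=> HT; apply: locfin_seq => v; have [B HB] := HT v.
pose s := [seq i%:Z - B%:Z | i <- iota 0 (2 * B).+1].
exists [seq (i, j) | i <- s, j <- s] => -[k l] kB; apply: HB; apply: contraR kB.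
rewrite negb_or -!leqNgt.
case/andP=> kB lB; have {}kB : (absz k <= B)%N := kB; have {}lB : (absz l <= B)%N := lB.
apply: (@allpairs_f _ _ _ pair); apply/mapP.
  by exists (absz (k + B%:Z)); rewrite ?mem_iota; lia.
by exists (absz (l + B%:Z)); rewrite ?mem_iota; lia.
Qed.

(** * Normally ordered products in a smooth Weyl module *)

Section WeylModules.
Variables (F : fieldType) (V : lmodType F) (g : weyl_idx -> endo V).
Hypothesis gC : forall x y, comm (g x) (g y) = weyl_form F x y *: (1 : endo V).
Hypothesis g_smooth : forall v, exists B : nat, forall n : int,
  B%:Z < n -> g (inl n) v = 0 /\ g (inr n) v = 0.

Local Notation A n := (g (inl n)).
Local Notation A' n := (g (inr n)).

Definition np (s : seq weyl_idx) : endo V := \prod_(x <- normal_order s) g x.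

Lemma commAA n m : comm (A n) (A m) = 0.
Proof. by rewrite gC scale0r. Qed.
Lemma commA'A' n m : comm (A' n) (A' m) = 0.
Proof. by rewrite gC scale0r. Qed.
Lemma A'C n m : A' n * A' m = A' m * A' n.
Proof. by rewrite mulCcomm commA'A' addr0. Qed.

(** The form pairs opposite indices only, and an index n >= 0 of [a] never cancels an index m >= 1
    of [a^*]. *)
Lemma annih_commute x y : annihilator x -> annihilator y -> g x * g y = g y * g x.
Proof.
move=> hx hy; rewrite mulCcomm gC; suff -> : weyl_form F x y = 0 by rewrite scale0r addr0.
case: x y hx hy => [n|n] [m|m] //= hn hm; case: eqP => //; try lia.
by rewrite oppr0.
Qed.

Lemma prod_annih0 s x v : all annihilator s -> x \in s -> g x v = 0 ->
  (\prod_(y <- s) g y) v = 0.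
Proof.
move=> sA xs gxv; have hx := allP sA x xs.
have xC t : all annihilator t -> g x * (\prod_(y <- t) g y) = (\prod_(y <- t) g y) * g x.
  elim: t => [|y t IHt] /=; first by rewrite big_nil mulr1 mul1r.
  by case/andP=> hy ht; rewrite big_cons mulrA annih_commute // -!mulrA IHt.
elim: s sA xs => //= y s IHs /andP [hy sA]; rewrite inE big_cons => /orP [/eqP <-|xs].
  by rewrite xC // endoE gxv linear0.
by rewrite endoE IHs // linear0.
Qed.

(** Annihilators stand on the right and commute with each other, so the one that kills [v] can act
    first. Local finiteness and the evaluation on the generator both rest on this. *)
Lemma np_annih0 s x v : x \in s -> annihilator x -> g x v = 0 -> np s v = 0.
Proof.
move=> xs hx gxv; rewrite /np /normal_order big_cat endoE.
by rewrite (@prod_annih0 _ x v) ?filter_all // ?mem_filter ?hx // linear0.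
Qed.

(** With scalar commutators the order of the factors does not affect the result, so normal ordering
    can be ignored. *)
Lemma comm_np2 y x1 x2 c1 c2 :
  comm y (g x1) = c1 *: (1 : endo V) -> comm y (g x2) = c2 *: (1 : endo V) ->
  comm y (np [:: x1; x2]) = c1 *: g x2 + c2 *: g x1.
Proof.
move=> h1 h2; rewrite /np /normal_order /=.
case: (annihilator x1); case: (annihilator x2); rewrite /= ?big_cons big_nil ?mulr1;
  rewrite commM h1 h2 -?endo_scaleAl -?endo_scaleAr mul1r mulr1 // addrC //.
Qed.

Lemma comm_np3 y x1 x2 x3 c1 c2 c3 : comm y (g x1) = c1 *: (1 : endo V) ->
  comm y (g x2) = c2 *: (1 : endo V) -> comm y (g x3) = c3 *: (1 : endo V) ->
  comm y (np [:: x1; x2; x3]) =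
    c1 *: np [:: x2; x3] + c2 *: np [:: x1; x3] + c3 *: np [:: x1; x2].
Proof.
move=> h1 h2 h3.
have E u1 u2 u3 d1 d2 d3 : comm y u1 = d1 *: (1 : endo V) ->
    comm y u2 = d2 *: (1 : endo V) -> comm y u3 = d3 *: (1 : endo V) ->
    comm y (u1 * (u2 * u3)) = d1 *: (u2 * u3) + d2 *: (u1 * u3) + d3 *: (u1 * u2).
  move=> e1 e2 e3; rewrite !commM e1 e2 e3 mulrDr -!endo_scaleAl -!endo_scaleAr.
  by rewrite !mul1r !mulr1 addrA.
rewrite /np /normal_order /=.
(* Moving the annihilators to the right without other changes yields five of the six orders of three
   factors; the reversal does not occur. *)
case: (annihilator x1); case: (annihilator x2); case: (annihilator x3);
  rewrite /= !big_cons !big_nil !mulr1;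
  first [ by rewrite (E _ _ _ _ _ _ h1 h2 h3)
        | by rewrite (E _ _ _ _ _ _ h2 h1 h3) [X in X + _]addrC
        | by rewrite (E _ _ _ _ _ _ h1 h3 h2) addrAC
        | by rewrite (E _ _ _ _ _ _ h2 h3 h1) addrC addrA
        | by rewrite (E _ _ _ _ _ _ h3 h1 h2) -addrA addrC ].
Qed.

Lemma comm_np_weight y (w : weyl_idx -> F) s :
  (forall x, comm y (g x) = w x *: g x) -> comm y (np s) = (\sum_(x <- s) w x) *: np s.
Proof.
move=> hy; have E t : comm y (\prod_(x <- t) g x) = (\sum_(x <- t) w x) *: (\prod_(x <- t) g x).
  elim: t => [|x t IHt].
    by rewrite !big_nil scale0r /comm mulr1 mul1r subrr.
  by rewrite !big_cons commM hy IHt -endo_scaleAl -endo_scaleAr scalerDl.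
rewrite /np E; congr (_ *: _); apply: perm_big.
by rewrite /normal_order perm_catC perm_filterC.
Qed.

Lemma commute_np y s : (forall x, comm y (g x) = 0) -> comm y (np s) = 0.
Proof.
move=> hy; rewrite (comm_np_weight (w := fun=> 0)); last by move=> x; rewrite hy scale0r.
by rewrite big1 ?scale0r.
Qed.

(** The index [k] alone decides: two creation operators keep their order, and two annihilators
    commute. *)
Lemma np_a'a k l : np [:: inr k; inl l] = if 1 <= k then A l * A' k else A' k * A l.
Proof.
rewrite /np /normal_order /=.
case k1: (1 <= k); case l1: (0 <= l); rewrite /= ?big_cons ?big_nil ?mulr1 //.
exact: annih_commute.
Qed.

Lemma np_a'a' k l : np [:: inr k; inr l] = A' k * A' l.
Proof.
rewrite /np /normal_order /=.
by case: (1 <= k); case: (1 <= l); rewrite /= ?big_cons ?big_nil ?mulr1 // A'C.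
Qed.

(** [J n], [Cub n] and [Q n] are the modes of :a^*(z)a(z):, :a^*(z)^2a(z): and a^*(z)^2. *)
Definition Jterm n k := np [:: inr k; inl (n - k)].
Definition J n := lsum (Jterm n).
Definition Cterm n (k : int * int) := np [:: inr k.1; inr k.2; inl (n - k.1 - k.2)].
Definition Cub n := lsum (Cterm n).
Definition Q n := lsum (fun k => A' k * A' (n - k)).

Lemma locfin_J n : locfin (Jterm n).
Proof.
apply: locfin_int => v; have [B HB] := g_smooth v; exists (B + absz n)%N => k kB.
have [k0|k0] := boolP (0 <= k).
  by apply: (np_annih0 (x := inr k)); rewrite ?inE ?eqxx //=; [lia|apply HB; lia].
by apply: (np_annih0 (x := inl (n - k))); rewrite ?inE ?eqxx ?orbT //=; [lia|apply HB; lia].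
Qed.

Lemma locfin_C n : locfin (Cterm n).
Proof.
(* If neither index of [a^*] exceeds [B], a very negative one pushes the index of [a] above [B]:
   from [k < -(2B + |n|)] and [l <= B] follows [n - k - l > B]. *)
apply: locfin_int2 => v; have [B HB] := g_smooth v; exists (2 * B + absz n)%N => -[k l] /= klB.
have [kB|kB] := ltrP B%:Z k.
  by apply: (np_annih0 (x := inr k)); rewrite ?inE ?eqxx //=; [lia|apply HB; lia].
have [lB|lB] := ltrP B%:Z l.
  by apply: (np_annih0 (x := inr l)); rewrite ?inE ?eqxx ?orbT //=; [lia|apply HB; lia].
by apply: (np_annih0 (x := inl (n - k - l))); rewrite ?inE ?eqxx ?orbT //=; [lia|apply HB; lia].
Qed.

Lemma locfin_Q n : locfin (fun k => A' k * A' (n - k)).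
Proof.
apply: locfin_int => v; have [B HB] := g_smooth v; exists (B + absz n)%N => k kB.
have [k0|k0] := boolP (0 <= k).
  by rewrite A'C endoE (proj2 (HB k _)) ?linear0 //; lia.
by rewrite endoE (proj2 (HB (n - k) _)) ?linear0 //; lia.
Qed.

Lemma comm_A_J m n : comm (A m) (J n) = A (n + m).
Proof.
rewrite comm_lsum; last exact: locfin_J.
have E k : comm (A m) (Jterm n k) = (m + k == 0)%:R *: A (n - k).
  by rewrite (comm_np2 (gC _ _) (gC _ _)) /= scale0r addr0.
rewrite (eq_lsum E) (lsum_supp1 (k := - m)).
  by rewrite subrr eqxx scale1r opprK.
move=> k km; have -> : (m + k == 0) = false by lia.
by rewrite scale0r.
Qed.

Lemma comm_A'_J m n : comm (A' m) (J n) = - A' (n + m).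
Proof.
rewrite comm_lsum; last exact: locfin_J.
have E k : comm (A' m) (Jterm n k) = (- (m + (n - k) == 0)%:R) *: A' k.
  by rewrite (comm_np2 (gC _ _) (gC _ _)) /= scale0r add0r.
rewrite (eq_lsum E) (lsum_supp1 (k := n + m)).
  have -> : m + (n - (n + m)) = 0 by lia.
  by rewrite eqxx scaleN1r.
move=> k km; have -> : (m + (n - k) == 0) = false by lia.
by rewrite oppr0 scale0r.
Qed.

(** [a(m)] contracts with either factor [a^*]; the two contractions agree up to exchanging the
    indices, whence the 2. *)
Lemma comm_A_C m n : comm (A m) (Cub n) = 2 *: J (n + m).
Proof.
rewrite comm_lsum; last exact: locfin_C.
pose T1 (k : int * int) := (m + k.1 == 0)%:R *: Jterm (n - k.1) k.2.
pose T2 (k : int * int) := (m + k.2 == 0)%:R *: Jterm (n - k.2) k.1.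
have E k : comm (A m) (Cterm n k) = T1 k + T2 k.
  rewrite (comm_np3 (gC _ _) (gC _ _) (gC _ _)) /= scale0r addr0 /T1 /T2 /Jterm.
  by rewrite [n - k.2 - k.1]addrAC.
(* Splitting the double sum requires local finiteness of each half; once the first index is fixed to
   [- m], it is that of [J (n + m)]. *)
have l1 : locfin T1.
  apply: locfin_int2 => v; have [S HS] := locfin_J (n + m) v.
  pose b := (\sum_(k <- S) absz k)%N.
  have Hb l : l \in S -> (absz l <= b)%N.
    by move=> lS; rewrite /b (big_fsetD1 l) //= leq_addr.
  exists (absz m + b)%N => -[k l] klB; rewrite /T1 /=.
  case: (eqVneq (m + k) 0) => [mk|_]; last by rewrite scale0r.
  have -> : n - k = n + m by lia.
  rewrite scale1r; apply: HS; apply/negP => /Hb {Hb}.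
  move: klB; rewrite /=; clearbody b; lia.
have l2 : locfin T2.
  move=> v; have [S HS] := l1 v.
  exists [fset (k.2, k.1) | k in S]%fset => -[k l] kl; apply: (HS (l, k)).
  by apply: contra kl => kl; apply/imfsetP; exists (l, k).
rewrite (eq_lsum E) lsumD // scaler_nat mulr2n; congr (_ + _).
  rewrite (lsum_inj (h := fun k => (- m, k)) (g := snd)) // /T1 /=.
    by apply: eq_lsum => k; rewrite subrr eqxx scale1r opprK.
  move=> [k l]; rewrite xpair_eqE eqxx andbT /= => mk.
  have -> : (m + k == 0) = false by lia.
  by rewrite scale0r.
rewrite (lsum_inj (h := fun k => (k, - m)) (g := fst)) // /T2 /=.
  by apply: eq_lsum => k; rewrite subrr eqxx scale1r opprK.
move=> [k l]; rewrite xpair_eqE eqxx /= => mk.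
have -> : (m + l == 0) = false by lia.
by rewrite scale0r.
Qed.

Lemma comm_A'_C m n : comm (A' m) (Cub n) = - Q (n + m).
Proof.
have lC := locfin_C n; rewrite comm_lsum //.
have E (k : int * int) : comm (A' m) (Cterm n k) =
    (- (m + (n - k.1 - k.2) == 0)%:R) *: (A' k.1 * A' k.2).
  by rewrite (comm_np3 (gC _ _) (gC _ _) (gC _ _)) /= !scale0r !add0r np_a'a'.
rewrite (lsum_inj (h := fun k => (k, n + m - k)) (g := fst)) //; last exact: locfin_comm.
  rewrite -(lsumN (@locfin_Q _)); apply: eq_lsum => k; rewrite E /=.
  have -> : m + (n - k - (n + m - k)) = 0 by lia.
  by rewrite eqxx scaleN1r.
move=> [k l] /=; rewrite E xpair_eqE eqxx /= => kl.
have -> : (m + (n - k - l) == 0) = false by lia.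
by rewrite oppr0 scale0r.
Qed.

End WeylModules.

(** * The Wakimoto operators and their brackets *)

Section WakimotoModes.
Variables (F : fieldType) (V : lmodType F) (g : weyl_idx -> endo V) (chi : int -> F).
Hypothesis gC : forall x y, comm (g x) (g y) = weyl_form F x y *: (1 : endo V).
Hypothesis g_smooth : forall v, exists B : nat, forall n : int,
  B%:Z < n -> g (inl n) v = 0 /\ g (inr n) v = 0.
Hypothesis chi_trunc : exists P : nat, forall n : int, P%:Z < n -> chi n = 0.

Local Notation A n := (g (inl n)).
Local Notation A' n := (g (inr n)).
Local Notation J := (J g).
Local Notation Cub := (Cub g).
Local Notation Q := (Q g).
Local Notation np := (np g).

(** Since [b(n)] acts by [chi n], the Wakimoto modes are locally finite expressions in the Weyl
    generators; [Sop] is the mode of a^*(z)b(z). *)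
Definition Hop n : endo V := (-2) *: J n + chi n *: (1 : endo V).
Definition Sop n : endo V := lsum (fun k => chi (n - k) *: A' k).
Definition Fop n : endo V := - Cub n + (2 * n%:~R) *: A' n + Sop n.

Lemma locfin_S n : locfin (fun k => chi (n - k) *: A' k).
Proof.
apply: locfin_int => v; have [B HB] := g_smooth v; have [P HP] := chi_trunc.
exists (B + P + absz n)%N => k kB; have [k0|k0] := boolP (0 <= k).
  by rewrite endoE (proj2 (HB k _)) ?scaler0 //; lia.
by rewrite HP ?scale0r //; lia.
Qed.

Lemma comm_A_H m n : comm (A m) (Hop n) = (-2) *: A (n + m).
Proof. by rewrite /Hop linearD /= linearZ /= comm1 addr0 comm_A_J. Qed.

Lemma comm_A'_H m n : comm (A' m) (Hop n) = 2 *: A' (n + m).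
Proof. by rewrite /Hop linearD /= linearZ /= comm1 addr0 comm_A'_J // scalerN scaleNr opprK. Qed.

Lemma comm_H_A n m : comm (Hop n) (A m) = 2 *: A (n + m).
Proof. by rewrite commC comm_A_H scaleNr opprK. Qed.

Lemma comm_H_A' n m : comm (Hop n) (A' m) = (-2) *: A' (n + m).
Proof. by rewrite commC comm_A'_H scaleNr. Qed.

Lemma comm_A_S m n : comm (A m) (Sop n) = chi (n + m) *: (1 : endo V).
Proof.
rewrite comm_lsum; last exact: locfin_S.
have E k : comm (A m) (chi (n - k) *: A' k) = (chi (n - k) * (m + k == 0)%:R) *: (1 : endo V).
  by rewrite linearZ /= gC scalerA.
rewrite (eq_lsum E) (lsum_supp1 (k := - m)) ?subrr ?eqxx ?mulr1 ?opprK //.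
move=> k km; have -> : (m + k == 0) = false by lia.
by rewrite mulr0 scale0r.
Qed.

Lemma comm_A'_S m n : comm (A' m) (Sop n) = 0.
Proof.
rewrite comm_lsum; last exact: locfin_S.
rewrite -[RHS](@lsum0 _ _ int); apply: eq_lsum => k.
by rewrite linearZ /= commA'A' // scaler0.
Qed.

(** The scalar comes from the derivative term of f(z): for [m = - n] it is [-2 m], the central term
    of [e(m), f(n)] at level -2. *)
Lemma comm_A_F m n : comm (A m) (Fop n) =
  Hop (n + m) + (2 * n%:~R * (n + m == 0)%:R) *: (1 : endo V).
Proof.
rewrite /Fop 2!linearD /= linearN linearZ /= comm_A_S comm_A_C // gC /= scalerA.
by rewrite [m + n]addrC /Hop scaleNr addrAC.
Qed.

Lemma comm_A'_F m n : comm (A' m) (Fop n) = Q (n + m).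
Proof.
rewrite /Fop 2!linearD /= linearN linearZ /= comm_A'_S comm_A'_C // commA'A' //.
by rewrite opprK scaler0 !addr0.
Qed.

Lemma locfin_step (n : int) : locfin (fun k : int =>
  ((1 <= k)%R%:R - (1 <= n + k)%R%:R : F) *: (1 : endo V)).
Proof.
apply: locfin_int => v; exists (1 + absz n)%N => k kn.
have -> : (1 <= n + k) = (1 <= k) by lia.
by rewrite subrr scale0r.
Qed.

(** The normal ordering anomaly: the value counts, with sign, the indices at which the two step
    functions differ. The induction runs in both directions, and passing from [n] to [n + 1] changes
    a single term, at [k = - n]. *)
Lemma lsum_step (n : int) : lsum (fun k : int =>
  ((1 <= k)%R%:R - (1 <= n + k)%R%:R : F) *: (1 : endo V)) = (- n%:~R : F) *: (1 : endo V).
Proof.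
have E (m : int) : lsum (fun k : int => ((1 <= k)%R%:R - (1 <= m + 1 + k)%R%:R : F) *: (1 : endo V)) =
    lsum (fun k : int => ((1 <= k)%R%:R - (1 <= m + k)%R%:R : F) *: (1 : endo V)) - 1.
  pose D k : endo V := ((1 <= m + k)%R%:R - (1 <= m + 1 + k)%R%:R : F) *: (1 : endo V).
  have D0 k : k != - m -> D k = 0.
    move=> km; rewrite /D; have -> : (1 <= m + 1 + k) = (1 <= m + k) by lia.
    by rewrite subrr scale0r.
  have <- : lsum D = - 1.
    rewrite (lsum_supp1 D0) /D.
    have -> : (1 <= m - m) = false by lia.
    have -> : (1 <= m + 1 - m) = true by lia.
    by rewrite sub0r scaleN1r.
  rewrite -lsumD; [|exact: locfin_step|exact: locfin_supp1 D0].
  by apply: eq_lsum => k; rewrite /D -scalerDl subrKA.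
have E0 : lsum (fun k : int => ((1 <= k)%R%:R - (1 <= (0 : int) + k)%R%:R : F) *: (1 : endo V)) = 0.
  rewrite -[RHS](@lsum0 _ _ int); apply: eq_lsum => k.
  by rewrite add0r subrr scale0r.
elim/int_rect: n => [|n IHn|n IHn].
- by rewrite E0 oppr0 scale0r.
- have -> : n.+1%:Z = n%:Z + 1 by lia.
  by rewrite E IHn intrD opprD scalerDl scaleN1r.
- have := E (- n.+1%:Z); have -> : - n.+1%:Z + 1 = - n%:Z by lia.
  rewrite IHn => E1; rewrite -[LHS](subrK 1) -E1.
  have -> : - n.+1%:Z = - n%:Z - 1 by lia.
  by rewrite intrD opprD opprK scalerDl scale1r.
Qed.

(** The bracket with a term of [J m] gives a term of [J (n + m)] minus a shifted product that is
    ordered according to [k], not to [n + k]. Restoring normal order costs a scalar when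
    [n + m = 0]; the ordered parts then cancel after reindexing, and the scalars add up by
    [lsum_step]. *)
Lemma comm_H_J n m :
  comm (Hop n) (J m) = (2 * n%:~R * (n + m == 0)%:R) *: (1 : endo V).
Proof.
have lJ := locfin_J gC g_smooth.
rewrite comm_lsum //; pose d : F := (n + m == 0)%:R.
have E k : comm (Hop n) (Jterm g m k) = 2 *: Jterm g (n + m) k +
    (- (2 *: Jterm g (n + m) (n + k)) +
     (- (2 * d)) *: (((1 <= k)%R%:R - (1 <= n + k)%R%:R : F) *: (1 : endo V))).
  have AA' k' l : A l * A' k' = A' k' * A l + (l + k' == 0)%:R *: (1 : endo V).
    by rewrite mulCcomm gC.
  have E1 : comm (Hop n) (Jterm g m k) = 2 *: Jterm g (n + m) k -
      2 *: (if 1 <= k then A (m - k) * A' (n + k) else A' (n + k) * A (m - k)).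
    rewrite /Jterm !np_a'a //; case: ifP => k1;
      rewrite commM comm_H_A comm_H_A' -endo_scaleAl -endo_scaleAr scaleNr [n + (m - k)]addrA //.
    by rewrite [LHS]addrC.
  rewrite E1 /Jterm !np_a'a //; congr (_ + _).
  have -> : n + m - (n + k) = m - k by lia.
  rewrite AA'; have -> : m - k + (n + k) = n + m by lia.
  rewrite -/d; case: (1 <= k); case: (1 <= n + k);
    rewrite ?subrr ?scale0r ?scaler0 ?addr0 // ?subr0 ?sub0r ?scale1r ?scaleN1r.
    by rewrite scalerDr opprD scalerA scaleNr.
  by rewrite scalerDr opprD scalerA scaleNr scalerN opprK subrK.
have lK : locfin (fun k => Jterm g (n + m) (n + k)).
  move=> v; have [S HS] := lJ (n + m) v.
  exists [fset k - n | k in S]%fset => k kS; apply: HS; apply: contra kS => kS.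
  by apply/imfsetP; exists (n + k) => //=; rewrite addrC addKr.
rewrite (eq_lsum E) lsumD; [|exact: locfinZ|apply: locfinD; last exact/locfinZ/locfin_step].
  rewrite lsumD; [|exact/locfinN/locfinZ|exact/locfinZ/locfin_step].
  rewrite lsumN ?lsumZ //; try exact: locfinZ; try exact: locfin_step.
  rewrite lsum_step scalerA.
  rewrite -(lsum_inj (h := fun k => n + k) (g := fun k => k - n)) //.
  - by rewrite addrA subrr add0r; congr (_ *: _); rewrite mulrNN mulrAC.
  - by move=> k /=; rewrite addrC addKr.
  - by move=> k; rewrite addrCA subrr addr0 eqxx.
exact/locfinN/locfinZ.
Qed.

(** The scalar is n K (h, h) with K = -2 and (h, h) = 2. The field [b] contributes nothing: at the
    critical level its modes commute. *)
Lemma comm_H_H n m :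
  comm (Hop n) (Hop m) = (- (4 * n%:~R * (n + m == 0)%:R)) *: (1 : endo V).
Proof.
rewrite [X in comm _ X]/Hop linearD /= linearZ /= comm1 addr0 comm_H_J scalerA.
by congr (_ *: _); ring.
Qed.

Definition weight (x : weyl_idx) : F := if x is inl _ then 2 else - 2.

Lemma comm_H0_g x : comm (Hop 0) (g x) = weight x *: g x.
Proof. by case: x => n; rewrite ?comm_H_A ?comm_H_A' add0r. Qed.

Lemma comm_H0_F n : comm (Hop 0) (Fop n) = (-2) *: Fop n.
Proof.
rewrite /Fop 2!linearD /= linearN linearZ /= comm_H_A' add0r !scalerDr scalerN.
congr (- _ + _ + _).
- have lC := locfin_C gC g_smooth n.
  rewrite comm_lsum // -lsumZ //; apply: eq_lsum => k.
  rewrite /Cterm (comm_np_weight _ comm_H0_g) !big_cons big_nil /=.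
  by congr (_ *: _); ring.
- by rewrite !scalerA mulrC.
have lS := locfin_S n.
rewrite comm_lsum // -lsumZ //; apply: eq_lsum => k.
by rewrite linearZ /= comm_H_A' add0r !scalerA mulrC.
Qed.

(** [Hop 0] is a locally finite sum of Weyl products plus a scalar. *)
Lemma commute_H0 x : (forall y, comm x (g y) = 0) -> comm (Hop 0) x = 0.
Proof.
move=> hx; rewrite commC; suff -> : comm x (Hop 0) = 0 by rewrite oppr0.
rewrite /Hop linearD /= linearZ /= comm1 addr0.
rewrite comm_lsum; last exact: locfin_J.
rewrite (eq_lsum (U := fun=> 0)) ?lsum0 ?scaler0 // => k.
exact: commute_np.
Qed.

(* An operator commuting with the Weyl algebra commutes with [Hop 0], so it
   vanishes as soon as it has nonzero weight. *)
Lemma commute_weight0 x c : c != 0 -> (forall y, comm (g y) x = 0) ->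
  comm (Hop 0) x = c *: x -> x = 0.
Proof.
move=> c0 hx; rewrite commute_H0 => [/esym E|y]; last by rewrite commC hx oppr0.
by rewrite -[x]scale1r -(mulVf c0) -scalerA E scaler0.
Qed.

Lemma comm_H_Q n m : comm (Hop n) (Q m) = (-4) *: Q (n + m).
Proof.
have lQ := locfin_Q gC g_smooth.
have lL : locfin (fun k => A' (n + k) * A' (m - k)).
  apply: locfin_int => v; have [S HS] := g_smooth v.
  exists (S + absz n + absz m)%N => k kS; have [k0|k0] := boolP (0 <= k).
    by rewrite A'C // endoE (proj2 (HS (n + k) _)) ?linear0 //; lia.
  by rewrite endoE (proj2 (HS (m - k) _)) ?linear0 //; lia.
rewrite comm_lsum //.
have E k : comm (Hop n) (A' k * A' (m - k)) =
    (-2) *: (A' (n + k) * A' (m - k)) + (-2) *: (A' k * A' (n + m - k)).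
  by rewrite commM !comm_H_A' -endo_scaleAl -endo_scaleAr addrA.
rewrite (eq_lsum E) lsumD ?lsumZ //; try exact: locfinZ.
have -> : lsum (fun k => A' (n + k) * A' (m - k)) = Q (n + m).
  rewrite /Q [RHS](lsum_inj (h := fun k => n + k) (g := fun k => k - n)) //.
  - by apply: eq_lsum => k; congr (_ * g (inr _)); lia.
  - by move=> k /=; rewrite addrC addKr.
  - by move=> k; rewrite addrCA subrr addr0 eqxx.
by rewrite -scalerDl; congr (_ *: _); ring.
Qed.

(* The sum is a mode of [a^*(z)^3]: the commutator depends on [n + m] only, so
   that [comm (Fop n) (Fop m)] commutes with every [A' k]. *)
Lemma comm_F_Q n m :
  comm (Fop n) (Q m) = (-2) *: lsum (fun k => A' k * Q (n + m - k)).
Proof.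
have lQ := locfin_Q gC g_smooth.
have A'Q k l : A' k * Q l = Q l * A' k.
  rewrite mulCcomm comm_lsum // (eq_lsum (U := fun=> 0)) ?lsum0 ?addr0 // => i.
  by rewrite commM !commA'A' // mul0r mulr0 addr0.
(* For very negative [k], every term of [Q (j - k)] has an index above [S], so that [Q (j - k)]
   kills [v]. *)
have lT j : locfin (fun k => A' k * Q (j - k)).
  apply: locfin_int => v; have [S HS] := g_smooth v.
  exists (2 * S + absz j)%N => k kS; have [k0|k0] := boolP (0 <= k).
    by rewrite A'Q endoE (proj2 (HS k _)) ?linear0 //; lia.
  rewrite endoE; suff -> : Q (j - k) v = 0 by rewrite linear0.
  rewrite (lsum_fset (A := fset0)) ?big_seq_fset0 // => i _.
  have [iS|iS] := ltrP S%:Z i.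
    by rewrite A'C // endoE (proj2 (HS i _)) ?linear0.
  by rewrite endoE (proj2 (HS _ _)) ?linear0 //; lia.
rewrite comm_lsum //.
have E k : comm (Fop n) (A' k * A' (m - k)) =
    - (A' (m - k) * Q (n + k)) - A' k * Q (n + m - k).
  rewrite commM commC comm_A'_F [comm (Fop n) _]commC comm_A'_F mulNr mulrN -A'Q.
  by rewrite [n + (m - k)]addrA.
(* The reflection [k -> m - k] turns one half of the bracket into the other. *)
have hinj : lsum (fun k => A' (m - k) * Q (n + k)) = lsum (fun k => A' k * Q (n + m - k)).
  rewrite [RHS](lsum_inj (h := fun k => m - k) (g := fun k => m - k)) //.
  - by apply: eq_lsum => k; congr (_ * Q _); lia.
  - by move=> k; lia.
  - by move=> k; rewrite opprB addrCA subrr addr0 eqxx.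
have lU : locfin (fun k => A' (m - k) * Q (n + k)).
  move=> v; have [S HS] := lT (n + m) v.
  exists [fset m - k | k in S]%fset => k kS.
  have -> : n + k = n + m - (m - k) by lia.
  apply: HS; apply: contra kS => kS.
  by apply/imfsetP; exists (m - k) => //=; lia.
rewrite (eq_lsum E) lsumD ?lsumN ?hinj //; try exact: locfinN.
by rewrite scaleNr scaler_nat mulr2n opprD.
Qed.

Hypothesis char0 : forall n : nat, (n.+1%:R : F) != 0.

Lemma commDr (x y z : endo V) : comm x (y + z) = comm x y + comm x z.
Proof. exact: linearD. Qed.
Lemma commZr c (x y : endo V) : comm x (c *: y) = c *: comm x y.
Proof. exact: linearZ. Qed.
Lemma commDl (x y z : endo V) : comm (x + y) z = comm x z + comm y z.
Proof. by rewrite /comm mulrDl mulrDr opprD addrACA. Qed.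
Lemma commZl c (x y : endo V) : comm (c *: x) y = c *: comm x y.
Proof. by rewrite /comm -endo_scaleAl -endo_scaleAr scalerBr. Qed.
Lemma comm1l c (x : endo V) : comm (c *: (1 : endo V)) x = 0.
Proof. by rewrite commC comm1 oppr0. Qed.

Lemma comm_H_F n m : comm (Hop n) (Fop m) = (-2) *: Fop (n + m).
Proof.
apply/eqP; rewrite -subr_eq0 scaleNr opprK; apply/eqP.
apply: (@commute_weight0 _ (-2)); first by rewrite oppr_eq0 (char0 1).
- move=> x; rewrite commDr commZr comm_comm; case: x => i.
    have comb (X U : endo V) (a b c a' b' : F) : a + a' = 0 -> a * b + c + a' * b' = 0 ->
        a *: (X + b *: U) + c *: U + a' *: (X + b' *: U) = 0.
      move=> aa' E; rewrite !scalerDr !scalerA -(addrA (a *: X)) -scalerDl addrACA.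
      by rewrite -!scalerDl aa' E !scale0r addr0.
    (* The scalars -4m, -4n and 4(n + m), all multiplied by the same delta, cancel. *)
    rewrite comm_A_H commZl !comm_A_F commDr comm1 addr0 comm_H_H.
    have -> : m + (n + i) = n + m + i by lia.
    have -> : n + (m + i) = n + m + i by lia.
    apply: comb; first by rewrite addNr.
    by rewrite intrD; ring.
  rewrite comm_A'_H commZl !comm_A'_F comm_H_Q.
  have -> : m + (n + i) = n + m + i by lia.
  have -> : n + (m + i) = n + m + i by lia.
  rewrite -!scalerDl; have -> : 2 + -4 + 2 = 0 :> F by ring.
  by rewrite scale0r.
rewrite commDr commZr comm_H0_F comm_comm comm_H0_F comm_H_H.
by rewrite comm1l add0r commZr [in RHS]scalerDr !scalerA [2 * -2]mulrC.
Qed.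

(** The two cubic sums are never multiplied out: the commutators of the bracket with [a(i)] and
    [a^*(i)] are differences of two terms that depend on [n + m + i] only, by [comm_H_F] and
    [comm_F_Q]. *)
Lemma comm_F_F n m : comm (Fop n) (Fop m) = 0.
Proof.
apply: (@commute_weight0 _ (-4)); first by rewrite oppr_eq0 (char0 3).
- move=> x; rewrite comm_comm; case: x => i.
    rewrite !comm_A_F commDr comm1 addr0 commDl comm1l addr0.
    rewrite [comm (Fop n) _]commC !comm_H_F.
    have -> : n + i + m = m + i + n by lia.
    by rewrite subrr.
  rewrite !comm_A'_F commC !comm_F_Q.
  have -> : m + (n + i) = n + (m + i) by lia.
  by rewrite addNr.
rewrite comm_comm !comm_H0_F commZr commZl -scalerDl.
by congr (_ *: _); ring.
Qed.

(** The scalar of [comm_A_F] is expressed by the index of [e], as in the affine bracket. *)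
Lemma comm_A_F' m n : comm (A m) (Fop n) =
  Hop (m + n) + (- (2 * m%:~R * (m + n == 0)%:R)) *: (1 : endo V).
Proof.
rewrite comm_A_F [n + m]addrC; congr (_ + _ *: _).
case: eqP => [mn|_]; last by rewrite !mulr0 oppr0.
have -> : n = - m by lia.
by rewrite intrN mulrN mulNr.
Qed.

End WakimotoModes.

(** * The representation of the affine algebra *)

Section WakimotoAction.
Variables (F : fieldType) (V : lmodType F) (g : weyl_idx -> endo V) (chi : int -> F).
Hypothesis gC : forall x y, comm (g x) (g y) = weyl_form F x y *: (1 : endo V).
Hypothesis g_smooth : forall v, exists B : nat, forall n : int,
  B%:Z < n -> g (inl n) v = 0 /\ g (inr n) v = 0.
Hypothesis chi_trunc : exists P : nat, forall n : int, P%:Z < n -> chi n = 0.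

Local Notation A n := (g (inl n)).
Local Notation A' n := (g (inr n)).

Definition sl2_op (x : sl2_idx) (n : int) : endo V :=
  match x with Idx_e => A n | Idx_h => Hop g chi n | Idx_f => Fop g chi n end.

Definition hat_op (i : hat_idx) : endo V :=
  if i is Some (x, n) then sl2_op x n else (-2) *: (1 : endo V).

Definition rho (x : sl2hat F) : endo V := lin_ext hat_op x.
HB.instance Definition _ :=
  GRing.isLinear.Build F (sl2hat F) (endo V) *:%R rho (lin_ext_linear hat_op).

Lemma rhoU i : rho << i >> = hat_op i. Proof. exact: lin_extU. Qed.

Lemma rho_loop x n : rho (loop x n) = lin_ext (fun i => sl2_op i n) x.
Proof.
rewrite /loop [lin_ext _ x in LHS]/lin_ext linear_sum; apply: eq_bigr => i _.
by rewrite linearZ /= rhoU.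
Qed.

Lemma rho_loopU i n : rho (loop << i >> n) = sl2_op i n.
Proof. by rewrite rho_loop lin_extU. Qed.

Lemma foldr_np s v : normal_product (fun n => A n) (fun n => A' n) s v = np g s v.
Proof.
rewrite /normal_product /np; elim: (normal_order s) => [|x t IHt]; first by rewrite big_nil.
by rewrite big_cons endoE /= -IHt; case: x.
Qed.

(** The action is defined by pointwise sums over all integers, with value 0 for infinite support;
    local finiteness identifies them with the operators [lsum]. *)
Lemma wakimoto_actE x v :
  wakimoto_act (fun n => A n) (fun n => A' n) (fun n w => chi n *: w) x v = rho x v.
Proof.
have evalE (f : hat_idx -> endo V) : lin_ext f x v = lin_ext (fun i => f i v) x.
  by rewrite /lin_ext; elim/big_ind2: _ => // [_ u _ w <- <-].
rewrite /wakimoto_act /rho evalE; congr lin_ext; apply/funext => -[[[] n]|]; rewrite /hat_op /sl2_op.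
- by [].
- rewrite /wakimoto_f /Fop !endoDE endoNE endoZE; congr (- _ + _ + _).
    rewrite lsumE; last exact: locfin_C.
    by apply: eq_fsbigr => k _; rewrite foldr_np.
  rewrite lsumE; last exact: locfin_S.
  by apply: eq_fsbigr => k _; rewrite endoE linearZ.
- rewrite /wakimoto_h /Hop endoDE !endoZE; congr (_ *: _ + _).
  rewrite lsumE; last exact: locfin_J.
  by apply: eq_fsbigr => k _; rewrite foldr_np.
- by [].
Qed.

Hypothesis char0 : forall n : nat, (n.+1%:R : F) != 0.

Lemma rho_lie x y : rho (lie x y) = comm (rho x) (rho y).
Proof.
rewrite -[lie x y]/(hat_bracket x y).
elim/hat_basis_ind: x => [|c u v IHu IHv|i].
- by rewrite hat_bracket0l !linear0 /comm mul0r mulr0 subrr.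
- by rewrite hat_bracket_linearl !linearP /= commDl commZl IHu IHv.
elim/hat_basis_ind: y => [|c u v IHu IHv|j].
- by rewrite !linear0.
- by rewrite hat_bracket_linearr !linearP /= IHu IHv.
rewrite hat_bracketU !rhoU.
case: i j => [[x n]|] [[y m]|]; rewrite /= ?comm1 ?comm1l ?linear0 //.
rewrite linearD linearZ /= -[hat_K F]/(<< None >> : sl2hat F) rhoU /= scalerA.
(* The central term of the affine bracket, with [K] acting as -2. *)
have scal (b : bool) (c : F) X : X = (- (c * 2 * b%:R)) *: (1 : endo V) ->
    ((if b then c else 0) * -2) *: (1 : endo V) = X.
  move=> ->; case: b; congr (_ *: _); rewrite ?mulr1 ?mulr0 ?mul0r ?oppr0 ?mulrN //.
have L0 k : rho (loop 0 k) = 0 by rewrite rho_loop linear0.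
have LN u k : rho (loop (- u) k) = - rho (loop u k) by rewrite !rho_loop linearN.
have LZ c u k : rho (loop (c *: u) k) = c *: rho (loop u k) by rewrite !rho_loop linearZ.
case: x y => [] [] /=; rewrite ?L0 ?LN ?LZ ?rho_loopU ?mulr0 ?mulr1 ?if_same ?mul0r ?scale0r
  ?add0r ?addr0 /=.
(* The nine cases are ee, ef, eh, fe, ff, fh, he, hf, hh. *)
- by rewrite commAA.
- rewrite comm_A_F' //; congr (_ + _); apply: scal.
  by congr ((- _) *: _); ring.
- by rewrite comm_A_H // [m + n]addrC scaleNr.
- rewrite commC comm_A_F' // [m + n]addrC [RHS]opprD; congr (_ + _).
  apply: scal; rewrite -scaleNr opprK; congr (_ *: _).
  case: eqP => [nm|_]; last by rewrite !mulr0 oppr0.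
  have -> : n = - m by lia.
  by rewrite intrN; ring.
- by rewrite comm_F_F.
- by rewrite commC comm_H_F // scaleNr opprK [m + n]addrC.
- by rewrite comm_H_A.
- by rewrite comm_H_F // scaleNr.
rewrite comm_H_H //; apply: scal; congr ((- _) *: _).
by ring.
Qed.

Lemma rho_lie_module : lie_module (fun x v => rho x v).
Proof.
split=> [v c x y|x|x y v]; first by rewrite linearP.
  exact: endo_linear.
by rewrite rho_lie.
Qed.

Lemma rho_smooth v (x : sl2 F) : exists N : int, forall n, N <= n -> rho (loop x n) v = 0.
Proof.
have [B HB] := g_smooth v; have [P HP] := chi_trunc.
have A0 n : B%:Z < n -> A n v = 0 by case/HB.
have A'0 n : B%:Z < n -> A' n v = 0 by case/HB.
have lsum0v (I : choiceType) (T : I -> endo V) : locfin T -> (forall k, T k v = 0) ->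
    lsum T v = 0.
  by move=> lT HT; rewrite (lsum_fset (A := fset0)) ?big_seq_fset0.
(* For indices [k, l <= B] of [a^*], the bound [3B] leaves an index above [B] for [a]; the summand
   [P] makes [chi (n - k)] vanish for [k <= B]. *)
exists (3 * B%:Z + P%:Z + 1) => n nB; suff Hop0 i : sl2_op i n v = 0.
  rewrite rho_loop /lin_ext.
  have : forall s : seq sl2_idx, (\sum_(b <- s) x@_b *: sl2_op b n) v = 0.
    elim=> [|i s IHs]; first by rewrite big_nil.
    by rewrite big_cons !endoE Hop0 IHs scaler0 addr0.
  by apply.
case: i; rewrite /sl2_op; first by apply: A0; lia.
- have H1 : Cub g n v = 0.
    apply: lsum0v => [|[k l]]; first exact: locfin_C.
    have [kB|kB] := ltrP B%:Z k.
      by apply: (np_annih0 gC (x := inr k)); rewrite ?inE ?eqxx //=; [lia|apply A'0; lia].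
    have [lB|lB] := ltrP B%:Z l.
      by apply: (np_annih0 gC (x := inr l)); rewrite ?inE ?eqxx ?orbT //=; [lia|apply A'0; lia].
    by apply: (np_annih0 gC (x := inl (n - k - l))); rewrite ?inE ?eqxx ?orbT //=;
      [lia|apply A0; lia].
  have H2 : Sop g chi n v = 0.
    apply: lsum0v => [|k]; first exact: locfin_S.
    have [kB|kB] := ltrP B%:Z k; first by rewrite endoE A'0 // scaler0.
    by rewrite HP ?scale0r //; lia.
  by rewrite /Fop !endoDE endoNE endoZE H1 H2 A'0 ?scaler0 ?oppr0 ?addr0 //; lia.
have H1 : J g n v = 0.
  apply: lsum0v => [|k]; first exact: locfin_J.
  have [kB|kB] := ltrP B%:Z k.
    by apply: (np_annih0 gC (x := inr k)); rewrite ?inE ?eqxx //=; [lia|apply A'0; lia].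
  by apply: (np_annih0 gC (x := inl (n - k))); rewrite ?inE ?eqxx ?orbT //=;
    [lia|apply A0; lia].
by rewrite /Hop endoDE !endoZE H1 HP ?scale0r ?scaler0 ?addr0 //; lia.
Qed.

End WakimotoAction.

(** * Whittaker vectors and simplicity *)

Section WhittakerVectors.
Variables (F : fieldType) (V : lmodType F) (g : weyl_idx -> endo V).
Variables (lam mu : nat -> F) (v0 : V).
Hypothesis gC : forall x y, comm (g x) (g y) = weyl_form F x y *: (1 : endo V).
Hypothesis char0 : forall n : nat, (n.+1%:R : F) != 0.

Local Notation A n := (g (inl n)).
Local Notation A' n := (g (inr n)).

Definition whit_char (x : weyl_idx) : F :=
  match x with inl n => lam (absz n) | inr n => mu (absz n) end.

Hypothesis v0_whit : forall x, annihilator x -> g x v0 = whit_char x *: v0.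
Hypothesis lam_trunc : exists N : nat, forall i, (N < i)%N -> lam i = 0.
Hypothesis mu_trunc : exists M : nat, forall i, (M < i)%N -> mu i = 0.

Definition lin_closed (P : V -> Prop) : Prop :=
  forall c u w, P u -> P w -> P (c *: u + w).

(** [v0] generates [V] over the Weyl algebra; the form of an induction principle avoids choosing a
    basis. *)
Hypothesis cyclic : forall P : V -> Prop, lin_closed P -> P v0 ->
  (forall x w, P w -> P (g x w)) -> forall w, P w.

Lemma lin_closed0 P u : lin_closed P -> P u -> P 0.
Proof. by move=> HP Pu; have := HP (-1) _ _ Pu Pu; rewrite scaleN1r addNr. Qed.

Lemma lin_closedZ P c u : lin_closed P -> P u -> P (c *: u).
Proof. by move=> HP Pu; have := HP c _ _ Pu (lin_closed0 HP Pu); rewrite addr0. Qed.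

Lemma gg x y w : g x (g y w) = g y (g x w) + weyl_form F x y *: w.
Proof.
have -> : g x (g y w) = (g x * g y) w by [].
by rewrite mulCcomm gC.
Qed.

(** For large [n] the modes [a(n)] and [a^*(n)] kill [v0] and commute with any given generator. *)
Lemma weyl_smooth w : exists B : nat, forall n : int,
  B%:Z < n -> A n w = 0 /\ A' n w = 0.
Proof.
elim/cyclic: w => [c u w [B HB] [C HC]||x w [B HB]].
- exists (B + C)%N => n nB; have [hB hB'] := HB n ltac:(lia).
  have [hC hC'] := HC n ltac:(lia).
  by rewrite !linearP /= hB hB' hC hC' !scaler0 !addr0.
- have [N HN] := lam_trunc; have [M HM] := mu_trunc.
  exists (N + M)%N => n nB; rewrite !v0_whit /=; try lia.
  by rewrite HN ?HM ?scale0r //; lia.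
pose b := absz (match x with inl n | inr n => n end).
exists (B + b)%N => n nB; have [h h'] := HB n ltac:(lia).
rewrite (gg (inl n)) (gg (inr n)) h h' !linear0 !add0r.
have form0 y : y = inl n \/ y = inr n -> weyl_form F y x = 0.
  have n0 m : absz m = b -> (n + m == 0) = false by lia.
  case=> ->; rewrite /b in n0 *; case: x {nB b} n0 => m n0 //=; rewrite n0 ?oppr0 //.
by rewrite !form0 ?scale0r //; [right|left].
Qed.

(** The span [K] of the products of creation operators on [v0] is stable under annihilators, which
    move to the right up to scalars until they meet [v0]. *)
Lemma cyclic_creation (P : V -> Prop) : lin_closed P -> P v0 ->
  (forall x w, ~~ annihilator x -> P w -> P (g x w)) -> forall w, P w.
Proof.
move=> linP P0 PC; pose K w := forall Q : V -> Prop, lin_closed Q -> Q v0 ->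
  (forall x u, ~~ annihilator x -> Q u -> Q (g x u)) -> Q w.
suff HK w : K w by move=> w; exact: HK.
have Klin : lin_closed K by move=> c u t Ku Kt Q Q1 Q2 Q3; apply: (Q1); [exact: (Ku Q)|exact: (Kt Q)].
have K0 : K v0 by move=> Q.
elim/cyclic: w => // x w Kw.
have [hx|hx] := boolP (annihilator x); last by move=> Q Q1 Q2 Q3; apply: (Q3) => //; exact: (Kw Q).
suff [] : K w /\ K (g x w) by [].
(* Induction inside [K], with the stability under [g x] carried along. *)
apply: (Kw (fun u => K u /\ K (g x u))) => [c u t [Ku Kgu] [Kt Kgt]||y u hy [Ku Kgu]].
- by split; [apply: Klin|rewrite linearP /=; apply: Klin].
- by split=> //; rewrite v0_whit //; exact: (@lin_closedZ K).
have Kc t : K t -> K (g y t) by move=> Kt Q Q1 Q2 Q3; apply: (Q3) => //; exact: (Kt Q).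
split; first exact: Kc.
by rewrite gg addrC; apply: Klin => //; apply: Kc.
Qed.

(** A creation operator times its conjugate annihilator, the latter shifted by its eigenvalue so
    that [v0] is killed. The sign for [k >= 1] comes from [a^*(k), a(-k)] = -1. The sum counts the
    creation operators applied to [v0]. *)
Definition euler_term (k : int) : endo V :=
  if 1 <= k then - (A (- k) * (A' k - whit_char (inr k) *: (1 : endo V)))
  else A' k * (A (- k) - whit_char (inl (- k)) *: (1 : endo V)).
Definition euler := lsum euler_term.

Lemma locfin_euler : locfin euler_term.
Proof.
apply: locfin_int => w; have [B HB] := weyl_smooth w.
have [N HN] := lam_trunc; have [M HM] := mu_trunc.
exists (B + N + M)%N => k kB; rewrite /euler_term; case: ifP => k1.
  rewrite endoNE endoME endoDE endoNE endoZE endo1E /= HM; last lia.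
  by rewrite (proj2 (HB k _)) ?scale0r ?subr0 ?linear0 ?oppr0 //; lia.
rewrite endoME endoDE endoNE endoZE endo1E /= HN; last lia.
by rewrite (proj1 (HB (- k) _)) ?scale0r ?subr0 ?linear0 //; lia.
Qed.

Lemma euler_creation y : ~~ annihilator y -> euler * g y = g y * (euler + 1).
Proof.
move=> hy; rewrite mulrDr mulr1 mulCcomm; congr (_ + _).
rewrite commC comm_lsum; last exact: locfin_euler.
pose k0 := match y with inl m => - m | inr m => m end.
have E k : comm (g y) (euler_term k) = if k == k0 then - g y else 0.
  rewrite /euler_term /k0 {k0}; case: ifP => k1; case: y hy => m /= hm.
  - rewrite linearN /= commM linearB /= comm1 subr0 !gC /= scale0r mul0r add0r.
    rewrite -endo_scaleAr mulr1.
    have [->|km] := eqVneq k (- m); first by rewrite subrr eqxx opprK scale1r.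
    have -> : (m + k == 0) = false by lia.
    by rewrite scale0r oppr0.
  - rewrite linearN /= commM linearB /= comm1 subr0 !gC /=.
    have -> : (m - k == 0) = false by lia.
    have -> : (k == m) = false by lia.
    by rewrite oppr0 !scale0r mul0r mulr0 addr0 oppr0.
  - rewrite commM linearB /= comm1 subr0 !gC /=.
    have -> : (m + k == 0) = false by lia.
    have -> : (k == - m) = false by lia.
    by rewrite !scale0r mul0r mulr0 addr0.
  rewrite commM linearB /= comm1 subr0 !gC /= scale0r mul0r add0r -endo_scaleAr mulr1.
  have [->|km] := eqVneq k m; first by rewrite subrr eqxx scaleN1r.
  have -> : (m - k == 0) = false by lia.
  by rewrite oppr0 scale0r.
rewrite (eq_lsum E) (lsum_supp1 (k := k0)) ?eqxx ?opprK // => k.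
by move/negbTE ->.
Qed.

Definition is_whittaker (w : V) : Prop :=
  forall x, annihilator x -> g x w = whit_char x *: w.

Lemma euler_whittaker w : is_whittaker w -> euler w = 0.
Proof.
move=> hw; rewrite (lsum_fset (A := fset0)) ?big_seq_fset0 //; first exact: locfin_euler.
move=> k _; rewrite /euler_term; case: ifP => k1.
  by rewrite endoNE endoME endoDE endoNE endoZE endo1E hw ?subrr ?linear0 ?oppr0 //=.
by rewrite endoME endoDE endoNE endoZE endo1E hw ?subrr ?linear0 //=; lia.
Qed.

(* The product of [euler - i] for [1 <= i <= d], which kills the part of degree
   between [1] and [d] of the module. *)
Fixpoint euler_prod (d : nat) : endo V :=
  if d is d'.+1 then (euler - d'.+1%:R *: (1 : endo V)) * euler_prod d' else 1.

Lemma euler_prodSE d u :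
  euler_prod d.+1 u = (euler - d.+1%:R *: (1 : endo V)) (euler_prod d u).
Proof. by []. Qed.

Lemma euler_prodC d : euler * euler_prod d = euler_prod d * euler.
Proof.
elim: d => [|d IHd] /=; first by rewrite mul1r mulr1.
have -> : euler * ((euler - d.+1%:R *: (1 : endo V)) * euler_prod d) =
    (euler - d.+1%:R *: (1 : endo V)) * (euler * euler_prod d).
  rewrite !mulrA; congr (_ * _).
  by rewrite mulrDl mulrDr mulrN mulNr -endo_scaleAl -endo_scaleAr mul1r mulr1.
by rewrite IHd mulrA.
Qed.

(** Moving [euler - (i + 1)] past a creation operator turns it into [euler - i], so the shifts 1,
    ..., d + 1 become 0, ..., d. *)
Lemma euler_prod_creation y d : ~~ annihilator y ->
  euler_prod d.+1 * g y = g y * (euler * euler_prod d).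
Proof.
move=> hy; have E i : (euler - i.+1%:R *: (1 : endo V)) * g y =
    g y * (euler - i%:R *: (1 : endo V)).
  rewrite mulrDl euler_creation // mulNr -endo_scaleAl mul1r.
  rewrite !mulrDr mulr1 mulrN -endo_scaleAr mulr1 -addrA; congr (_ + _).
  by rewrite mulrSr scalerDl scale1r opprD addrCA addrN addr0.
elim: d => [|d IHd]; first by rewrite [euler_prod 1]/= !mulr1 E scale0r subr0.
rewrite [euler_prod d.+2]/= -/(euler_prod d.+1) -mulrA IHd mulrA E.
rewrite euler_prodC -mulrA [in RHS]euler_prodC /=; congr (_ * _).
by rewrite !mulrA.
Qed.

Lemma euler_prod_leq d d' u : (d <= d')%N -> euler_prod d u = 0 -> euler_prod d' u = 0.
Proof.
move=> /subnK <-; elim: (d' - d)%N => // k IHk /IHk E.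
by rewrite addSn euler_prodSE E linear0.
Qed.

(** [c *: v0] is the part of [w] of degree 0, found without constructing a grading of [V]. A vector
    in the image of a creation operator has no such part, so [c = 0] there. *)
Lemma degree_decomposition w : exists c d, euler_prod d (w - c *: v0) = 0.
Proof.
elim/cyclic_creation: w => [c u w [a [d Hu]] [b [e Hw]]||x w hx [c [d Hw]]].
- exists (c * a + b), (maxn d e).
  have -> : c *: u + w - (c * a + b) *: v0 = c *: (u - a *: v0) + (w - b *: v0).
    by rewrite scalerDl -scalerA scalerBr addrACA opprD.
  rewrite linearP /= (euler_prod_leq _ Hu) ?leq_maxl // (euler_prod_leq _ Hw) ?leq_maxr //.
  by rewrite scaler0 addr0.
- by exists 1, 0%N; rewrite scale1r subrr linear0.
exists 0, d.+1; rewrite scale0r subr0.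
have -> : euler_prod d.+1 (g x w) = g x (euler (euler_prod d w)).
  by rewrite -[LHS]/((euler_prod d.+1 * g x) w) euler_prod_creation.
have -> : euler_prod d w = euler_prod d (c *: v0).
  by rewrite -{1}[w](subrK (c *: v0)) linearD /= Hw add0r.
have -> : euler (euler_prod d (c *: v0)) = euler_prod d (euler (c *: v0)).
  by rewrite -[LHS]/((euler * euler_prod d) (c *: v0)) euler_prodC.
by rewrite linearZ /= euler_whittaker // scaler0 !linear0.
Qed.

Lemma whittaker_unique w : is_whittaker w -> exists c, w = c *: v0.
Proof.
move=> hw; have [c [d Hd]] := degree_decomposition w; exists c.
apply/eqP; rewrite -subr_eq0; apply/eqP; set u := w - _ in Hd *.
have Eu : euler u = 0.
  by rewrite /u linearB linearZ /= !euler_whittaker ?scaler0 ?subr0.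
(* Here [s] is (-1)^d d!, nonzero in characteristic 0. *)
have [s s0 Es] : exists2 s : F, s != 0 & euler_prod d u = s *: u.
  elim: d {Hd} => [|d [s s0 Es]]; first by exists 1; rewrite ?oner_neq0 // scale1r.
  exists (- (d.+1%:R * s)); first by rewrite oppr_eq0 mulf_neq0.
  rewrite euler_prodSE Es.
  have -> : (euler - d.+1%:R *: (1 : endo V)) (s *: u) = s *: (euler u - d.+1%:R *: u).
    by rewrite linearZ.
  by rewrite Eu sub0r scalerN scalerA scaleNr mulrC.
by rewrite -[u]scale1r -(mulVf s0) -scalerA -Es Hd scaler0.
Qed.

Definition shifted x : endo V := g x - whit_char x *: (1 : endo V).

Lemma shiftedE x w : shifted x w = g x w - whit_char x *: w.
Proof. by []. Qed.

(** A bound on the order of local nilpotency of the shifted annihilators: [nilp 1] amounts to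
    [is_whittaker]. Both [weyl_simple] and [W_A'] are inductions on [d]. *)
Fixpoint nilp (d : nat) (w : V) : Prop :=
  if d is d'.+1 then forall x, annihilator x -> nilp d' (shifted x w) else w = 0.

Lemma nilp_lin d : lin_closed (nilp d).
Proof.
elim: d => [|d IHd] c u w; first by move=> /= -> ->; rewrite scaler0 addr0.
move=> hu hw x hx.
rewrite (linearP (shifted x)); apply: IHd; [exact: hu|exact: hw].
Qed.

Lemma nilpS d w : nilp d w -> nilp d.+1 w.
Proof.
elim: d w => [|d IHd] w; first by move=> -> x _; rewrite linear0.
by move=> hw x hx; apply/IHd/hw.
Qed.

Lemma nilp_leq d e w : (d <= e)%N -> nilp d w -> nilp e w.
Proof. by move=> /subnK <- hw; elim: (e - d)%N => // k /nilpS. Qed.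

(** A shifted annihilator commutes with [g y] up to a scalar, so a generator raises the order by at
    most one. *)
Lemma nilp_g d w y : nilp d w -> nilp d.+1 (g y w).
Proof.
elim: d w => [|d IHd] w; first by move=> -> x _; rewrite !linear0.
move=> hw x hx.
have -> : shifted x (g y w) = weyl_form F x y *: w + g y (shifted x w).
  by rewrite !shiftedE gg [g y (_ - _)]linearB [in RHS](linearZ_LR (g y)) addrAC addrC.
apply: (@nilp_lin d.+1); first exact: hw.
exact/IHd/hw.
Qed.

Lemma nilp_all w : exists d, nilp d w.
Proof.
elim/cyclic: w => [c u w [d Hu] [e Hw]||x w [d Hw]].
- exists (maxn d e); apply: nilp_lin; first exact: nilp_leq (leq_maxl _ _) Hu.
  exact: nilp_leq (leq_maxr _ _) Hw.
- by exists 1%N => x hx; rewrite shiftedE v0_whit // subrr.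
by exists d.+1; apply: nilp_g.
Qed.

Section Submodules.
Variable W : {pred V}.
Hypothesis Wsub : submod_closed W.

Let W0 : 0 \in W. Proof. by case: Wsub. Qed.
Let WP c u w : u \in W -> w \in W -> c *: u + w \in W.
Proof. by case: Wsub => _; apply. Qed.
Let WZ c u : u \in W -> c *: u \in W.
Proof. by move=> hu; rewrite -[_ *: _]addr0 WP. Qed.
Let WD u w : u \in W -> w \in W -> u + w \in W.
Proof. by move=> hu hw; rewrite -[u]scale1r WP. Qed.
Let WB u w : u \in W -> w \in W -> u - w \in W.
Proof. by move=> hu hw; rewrite -scaleN1r addrC WP. Qed.
Let WZE c u : c != 0 -> c *: u \in W -> u \in W.
Proof. by move=> c0 /(WZ c^-1); rewrite scalerA mulVf // scale1r. Qed.

Lemma weyl_simple : (forall x w, w \in W -> g x w \in W) ->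
  (forall w, w \in W -> w = 0) \/ (forall w, w \in W).
Proof.
move=> Wg; have [[w wW w0]|noW] := pselect (exists2 w, w \in W & w <> 0); last first.
  by left=> w wW; apply: contrapT => w0; apply: noW; exists w.
right; have [d Hd] := nilp_all w.
have [u [uW u0 hu]] : exists u, [/\ u \in W, u <> 0 & is_whittaker u].
  (* A vector that is not Whittaker is replaced by a nonzero shifted image of smaller order, still
     in [W]. *)
  elim: d w wW w0 Hd => [|d IHd] w wW w0 Hd //.
  have [hw|] := pselect (is_whittaker w); first by exists w.
  move/existsNP => [x /not_implyP [hx Hx]].
  apply: (IHd (shifted x w)); last exact: Hd.
    by rewrite shiftedE; apply: WB; [apply: Wg|apply: WZ].
  by rewrite shiftedE => /eqP; rewrite subr_eq0 => /eqP.
have [c uE] := whittaker_unique hu.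
have v0W : v0 \in W.
  apply: (@WZE c); last by rewrite -uE.
  by apply/eqP => c0; apply: u0; rewrite uE c0 scale0r.
by move=> t; elim/cyclic: t.
Qed.

Variable (chi : int -> F) (N : nat).
Hypothesis lamN : lam N != 0.
Hypothesis lamN0 : forall i, (N < i)%N -> lam i = 0.
Hypothesis We : forall n w, w \in W -> A n w \in W.
Hypothesis Wh : forall n w, w \in W -> Hop g chi n w \in W.

Lemma W_J n w : w \in W -> J g n w \in W.
Proof.
move=> wW; apply: (@WZE (- 2)); first by rewrite oppr_eq0 (char0 1).
have -> : -2 *: J g n w = Hop g chi n w - chi n *: w.
  by rewrite /Hop endoDE !endoZE endo1E addrK.
by apply: WB; [apply: Wh|apply: WZ].
Qed.

(** The two orders differ by a multiple of [w], so for [w] in [W] normal ordering does not affect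
    membership in [W]. *)
Lemma np_up_to_scalar k l w : exists c,
  np g [:: inr k; inl l] w = A' k (A l w) + c *: w /\ exists c',
  np g [:: inr k; inl l] w = A l (A' k w) + c' *: w.
Proof.
rewrite np_a'a //; case: ifP => _; rewrite endoME.
  by eexists; split; [apply: gg|exists 0; rewrite scale0r addr0].
by exists 0; rewrite scale0r addr0; split=> //; eexists; apply: gg.
Qed.

(* [Hop (k + N)] expresses [lam N *: A' k w] through [A' j w] with [j > k] and
   through vectors closer to being Whittaker vectors. *)
Lemma W_A' k w : w \in W -> A' k w \in W.
Proof.
have [d] := nilp_all w; elim: d w k => [|d IHd] w k; first by move=> -> _; rewrite linear0.
move=> Hd wW; have [B HB] := weyl_smooth w.
(* The inner induction descends on [k], starting above [B], where [a^*(k)] kills [w]. *)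
have [j] : exists j : nat, B%:Z - j%:Z < k by exists (absz k + B + 1)%N; lia.
elim: j k => [|j IHj] k kj.
  by rewrite (proj2 (HB k _)) //; lia.
have [/IHj //|kB] := boolP (B%:Z - j%:Z < k).
have AW l : 0 <= l -> forall i, A' i (shifted (inl l) w) \in W.
  move=> l0 i; apply: IHd; first exact: Hd.
  by rewrite shiftedE; apply: WB; [apply: We|apply: WZ].
have lJ := locfin_J gC weyl_smooth (k + N%:Z).
have [S HS] := lJ w.
(* [k] is adjoined to the support so that its term can be separated. *)
have HS' i : i \notin (k |` S)%fset -> Jterm g (k + N%:Z) i w = 0.
  by rewrite inE negb_or => /andP [_ /HS].
have : Jterm g (k + N%:Z) k w \in W.
  have := W_J (k + N%:Z) wW; rewrite /J (lsum_fset lJ HS').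
  rewrite (big_fsetD1 k) /= ?fset1U1 // => HW.
  rewrite -[X in X \in W](addrK (\sum_(i <- ((k |` S) `\ k)%fset) Jterm g (k + N%:Z) i w)).
  apply: WB => //; rewrite big_seq; elim/big_ind: _ => // i; rewrite !inE => /andP [ik _].
  rewrite /Jterm; have [c [E [c' E']]] := np_up_to_scalar i (k + N%:Z - i) w.
  (* For [i > k] the inner induction applies. For [i < k] the index [k + N - i] exceeds [N], so [a]
     at this index equals its shifted operator and the outer induction applies. *)
  have [ki|ki] := ltrP k i.
    by rewrite E' addrC; apply: WP => //; apply: We; apply: IHj; lia.
  rewrite E addrC; apply: WP => //.
  have -> : A (k + N%:Z - i) w = shifted (inl (k + N%:Z - i)) w.
    by rewrite shiftedE /= lamN0 ?scale0r ?subr0 //; lia.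
  by apply: AW; lia.
rewrite /Jterm; have -> : k + N%:Z - k = N%:Z by lia.
have [c [-> _]] := np_up_to_scalar k N%:Z w.
move=> HW; apply: (WZE lamN).
have -> : lam N *: A' k w = A' k (A N%:Z w) - A' k (shifted (inl N%:Z) w).
  by rewrite -linearB shiftedE opprB addrCA subrr addr0 linearZ.
apply: WB; last exact: AW.
by rewrite -[X in X \in W](addrK (c *: w)); apply: WB => //; apply: WZ.
Qed.

Lemma wakimoto_simple_sub : (forall w, w \in W -> w = 0) \/ (forall w, w \in W).
Proof. by apply: weyl_simple => -[] n w wW; [apply: We|apply: W_A']. Qed.

End Submodules.

Lemma rho_simple (chi : int -> F) (N : nat) : v0 <> 0 -> lam N != 0 ->
  (forall i, (N < i)%N -> lam i = 0) ->
  simple_module (fun x v => rho g chi x v).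
Proof.
move=> v00 lamN lamN0; split; first by exists v0.
move=> W Wsub Wrho; apply: (wakimoto_simple_sub Wsub lamN lamN0 (chi := chi)) => n w wW.
  by have := Wrho (hat_e F n) w wW; rewrite /hat_e rho_loopU.
by have := Wrho (hat_h F n) w wW; rewrite /hat_h rho_loopU.
Qed.

End WhittakerVectors.

(** * Eigenvalues of the operators on the generator *)

Lemma lsum_seq (F : fieldType) (V : lmodType F) (I : choiceType) (T : I -> endo V) v
    (s : seq I) : locfin T -> uniq s -> (forall i, i \notin s -> T i v = 0) ->
  lsum T v = \sum_(i <- s) T i v.
Proof.
move=> lT us Hs; rewrite lsumE // (fsbigE s) //; first by apply: eq_bigl => i; apply: mem_set.
by move=> i _; exact: Hs.
Qed.

Section Eigenvector.
Variables (F : fieldType) (V : lmodType F) (g : weyl_idx -> endo V).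
Variables (lam mu eta : nat -> F) (chi : int -> F) (v0 : V) (N M P : nat).
Hypothesis gC : forall x y, comm (g x) (g y) = weyl_form F x y *: (1 : endo V).
Hypothesis g_smooth : forall v, exists B : nat, forall n : int,
  B%:Z < n -> g (inl n) v = 0 /\ g (inr n) v = 0.
Hypothesis v0_whit : forall x, annihilator x -> g x v0 = whit_char lam mu x *: v0.
Hypothesis lam0 : forall i, (N < i)%N -> lam i = 0.
Hypothesis mu0 : forall i, (M < i)%N -> mu i = 0.
Hypothesis chi0 : forall n : int, P%:Z < n -> chi n = 0.
Hypothesis chi_eta : forall i : nat, chi i%:Z = eta i.
Hypothesis M1 : (1 <= M)%N.

Local Notation A n := (g (inl n)).
Local Notation A' n := (g (inr n)).

Lemma A'v0 (k : nat) : (1 <= k)%N -> A' k%:Z v0 = mu k *: v0.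
Proof. by move=> k1; rewrite v0_whit. Qed.

Lemma Av0 (k : nat) : A k%:Z v0 = lam k *: v0.
Proof. by rewrite v0_whit. Qed.

Lemma np_v0_eq0 s x : x \in s -> annihilator x -> whit_char lam mu x = 0 -> np g s v0 = 0.
Proof. by move=> xs hx ex; apply: (np_annih0 gC xs hx); rewrite v0_whit // ex scale0r. Qed.

Let chi_trunc : exists P : nat, forall n : int, P%:Z < n -> chi n = 0.
Proof. by exists P. Qed.

(** Terms with [k > M] vanish by [mu]; for [k <= 0] the index [n - k] exceeds [N]; for 1 <= k <= M
    it is nonnegative because [M <= n], so both factors act by their eigenvalues. The two bounds
    give q = max(M, N + 1). *)
Lemma J_v0 (n : nat) : (M <= n)%N -> (N < n)%N ->
  J g n v0 = (\sum_(1 <= l < M.+1) mu l * lam (n - l)%N) *: v0.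
Proof.
move=> Mn Nn; rewrite /J (lsum_seq (s := map Posz (index_iota 1 M.+1))).
- rewrite big_map scaler_suml !big_seq; apply: eq_bigr => l.
  rewrite mem_index_iota => /andP [l1 lM].
  rewrite /Jterm np_a'a //; have -> : 1 <= Posz l by lia.
  rewrite endoME A'v0 // linearZ /= -scalerA; congr (_ *: _).
  have -> : n%:Z - l%:Z = (n - l)%N%:Z by lia.
  by rewrite Av0.
- exact: locfin_J.
- by rewrite map_inj_uniq ?iota_uniq // => x y [].
move=> k; have [kM|kM] := ltrP M%:Z k.
  by move=> _; apply: (@np_v0_eq0 _ (inr k)); rewrite ?inE ?eqxx //=; [lia|rewrite mu0 //; lia].
have [k1|k1] := ltrP 0 k.
  move=> /negP []; apply/mapP; exists (absz k); last by lia.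
  by rewrite mem_index_iota; lia.
move=> _; apply: (@np_v0_eq0 _ (inl (n%:Z - k))); rewrite ?inE ?eqxx ?orbT //=; first lia.
by rewrite lam0 //; lia.
Qed.

Lemma H_v0 (n : nat) : (M <= n)%N -> (N < n)%N ->
  Hop g chi n v0 = ((-2) * (\sum_(1 <= l < M.+1) mu l * lam (n - l)%N) + eta n) *: v0.
Proof.
by move=> Mn Nn; rewrite /Hop endoDE !endoZE J_v0 // scalerA chi_eta -scalerDl.
Qed.

(** If [k, l <= M] and one of them is at most 0, then [n - k - l >= n - M > N] and the term
    vanishes. If both are at least 1, then [2M <= n] makes [a(n - k - l)] an annihilator. These are
    the first two bounds in r. *)
Lemma Cub_v0 (n : nat) : (M + N < n)%N -> (2 * M <= n)%N -> Cub g n v0 =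
  (\sum_(0 <= k1 < n.+1) \sum_(0 <= k2 < n.+1)
     \sum_(0 <= k3 < n.+1 | [&& (1 <= k1)%N, (1 <= k2)%N & (k1 + k2 + k3 == n)%N])
        mu k1 * mu k2 * lam k3) *: v0.
Proof.
move=> MNn Mn; pose ix := index_iota 0 n.+1.
rewrite /Cub (lsum_seq (s := [seq (Posz k, Posz l) | k <- ix, l <- ix])).
- rewrite big_allpairs_dep scaler_suml; apply: eq_bigr => k _.
  rewrite scaler_suml; apply: eq_bigr => l _.
  have [/and3P [k1 l1 kln]|] := boolP [&& (1 <= k)%N, (1 <= l)%N & (k + l <= n)%N].
    rewrite k1 l1 /=.
    have -> : \sum_(0 <= k3 < n.+1 | (k + l + k3 == n)%N) mu k * mu l * lam k3 =
        mu k * mu l * lam (n - k - l)%N.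
      rewrite (eq_bigl (fun j => j == n - k - l)%N) => [|j]; last by lia.
      by rewrite big_nat1_eq; have -> : (0 <= n - k - l < n.+1)%N by lia.
    rewrite /Cterm /np /normal_order /=.
    have -> : n%:Z - k%:Z - l%:Z = (n - k - l)%N%:Z by lia.
    have -> : 1 <= Posz k by lia.
    have -> : 1 <= Posz l by lia.
    rewrite /= !big_cons big_nil mulr1 !endoME Av0 linearZ /= A'v0 // linearZ /=.
    by rewrite linearZ /= A'v0 // !scalerA; congr (_ *: _); ring.
  move=> nkl; rewrite big_pred0 ?scale0r; last by move=> j; lia.
  rewrite /Cterm /=.
  have [kM|kM] := ltnP M k.
    by apply: (@np_v0_eq0 _ (inr k%:Z)); rewrite ?inE ?eqxx //=; [lia|rewrite mu0 //; lia].
  have [lM|lM] := ltnP M l.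
    by apply: (@np_v0_eq0 _ (inr l%:Z)); rewrite ?inE ?eqxx ?orbT //=; [lia|rewrite mu0 //; lia].
  apply: (@np_v0_eq0 _ (inl (n%:Z - k%:Z - l%:Z))); rewrite ?inE ?eqxx ?orbT //=; first lia.
  by rewrite lam0 //; lia.
- exact: locfin_C.
- by apply: allpairs_uniq; rewrite ?iota_uniq // => -[? ?] [? ?] _ _ [-> ->].
move=> [k l] kl; rewrite /Cterm /=.
have [kM|kM] := ltrP M%:Z k.
  by apply: (@np_v0_eq0 _ (inr k)); rewrite ?inE ?eqxx //=; [lia|rewrite mu0 //; lia].
have [lM|lM] := ltrP M%:Z l.
  by apply: (@np_v0_eq0 _ (inr l)); rewrite ?inE ?eqxx ?orbT //=; [lia|rewrite mu0 //; lia].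
have kl0 : (k < 0) || (l < 0).
  apply: contraR kl; rewrite negb_or -!leNgt => /andP [k0 l0].
  have -> : (k, l) = (Posz (absz k), Posz (absz l)) by congr pair; lia.
  by apply: (@allpairs_f _ _ _ (fun x y => (Posz x, Posz y))); rewrite mem_index_iota; lia.
apply: (@np_v0_eq0 _ (inl (n%:Z - k - l))); rewrite ?inE ?eqxx ?orbT //=; first lia.
by rewrite lam0 //; lia.
Qed.

(** For [k <= 0] the index [n - k] exceeds [P], which accounts for the bound P + 1 in r. *)
Lemma S_v0 (n : nat) : (P < n)%N -> (M < n)%N -> Sop g chi n v0 =
  (\sum_(0 <= j1 < n.+1) \sum_(0 <= j2 < n.+1 | (1 <= j1)%N && (j1 + j2 == n)%N)
     mu j1 * eta j2) *: v0.
Proof.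
move=> Pn Mn; rewrite /Sop (lsum_seq (s := map Posz (index_iota 0 n.+1))).
- rewrite big_map scaler_suml !big_seq; apply: eq_bigr => k.
  rewrite mem_index_iota => /andP [_ kn].
  have [k0|k1] := leqP k 0.
    rewrite big_pred0 ?scale0r; last by move=> j; lia.
    by rewrite chi0 ?scale0r //; lia.
  rewrite (eq_bigl (fun j => j == n - k)%N) => [|j]; last by lia.
  rewrite big_nat1_eq; have -> : (0 <= n - k < n.+1)%N by lia.
  have -> : n%:Z - k%:Z = (n - k)%N%:Z by lia.
  by rewrite endoZE A'v0 // chi_eta scalerA mulrC.
- exact: locfin_S.
- by rewrite map_inj_uniq ?iota_uniq // => x y [].
move=> k; have [kM|kM] := ltrP M%:Z k.
  by move=> _; rewrite endoZE v0_whit /= ?mu0 ?scale0r ?scaler0 //; lia.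
have [k0|k0] := ltrP k 0; first by move=> _; rewrite chi0 ?scale0r //; lia.
move=> /negP []; apply/mapP; exists (absz k); last by lia.
by rewrite mem_index_iota; lia.
Qed.

Lemma F_v0 (n : nat) : (M + N < n)%N -> (2 * M <= n)%N -> (P < n)%N -> Fop g chi n v0 =
  (- (\sum_(0 <= k1 < n.+1) \sum_(0 <= k2 < n.+1)
     \sum_(0 <= k3 < n.+1 | [&& (1 <= k1)%N, (1 <= k2)%N & (k1 + k2 + k3 == n)%N])
        mu k1 * mu k2 * lam k3)
   + (\sum_(0 <= j1 < n.+1) \sum_(0 <= j2 < n.+1 | (1 <= j1)%N && (j1 + j2 == n)%N)
     mu j1 * eta j2)
   + 2 * n%:R * mu n) *: v0.
Proof.
move=> MNn Mn Pn; rewrite /Fop !endoDE endoNE endoZE Cub_v0 // S_v0 //; last lia.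
rewrite A'v0; last lia.
by rewrite scalerA addrAC !scalerDl scaleNr.
Qed.

End Eigenvector.

(** * A Fock model: the Weyl module is nonzero *)

Section NonzeroEndomorphisms.
Variables (F : fieldType) (V : lmodType F) (v : V) (vn0 : v <> 0).

(** An [algType] has 1 != 0, so the type carries a proof that [V] is nonzero. *)
Definition endo_alg of v <> 0 := endo V.
Local Notation E := (endo_alg vn0).
HB.instance Definition _ := GRing.PzRing.on E.
HB.instance Definition _ := GRing.Lmodule.on E.

Lemma endo_alg_nonzero : 1 != 0 :> E.
Proof. by apply/eqP => /(congr1 (fun e : endo V => e v)). Qed.

HB.instance Definition _ := GRing.PzSemiRing_isNonZero.Build E endo_alg_nonzero.
HB.instance Definition _ := GRing.Lmodule_isLalgebra.Build F E (@endo_scaleAl F V).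
HB.instance Definition _ := GRing.Lalgebra_isAlgebra.Build F E (@endo_scaleAr F V).

End NonzeroEndomorphisms.

Lemma free_alg_ind (F : fieldType) (I : choiceType) (K : free_alg F I -> Prop) :
  lin_closed K -> K 1 -> (forall i t, K t -> K (free_gen F i * t)) -> forall t, K t.
Proof.
move=> Klin K1 Kgen.
have Kword (s : seq I) : K (<< FMonom s >> : {malg F[{fmonom I}]}).
  elim: s => [|i s IHs].
    suff <- : (1 : free_alg F I) = << FMonom [::] >> by [].
    rewrite -[1]/(free_one F I) free_oneE.
    by congr << _ >>; apply: val_inj; rewrite /= fm1.
  suff -> : << FMonom (i :: s) >> = free_gen F i * (<< FMonom s >> : free_alg F I) by exact: Kgen.
  rewrite -[_ * _]/(free_mul _ _) free_mulE free_genE malgM_def fgmulUU mulr1.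
  by congr << _ >>; apply: val_inj; rewrite /= fmM fmU.
move=> t; rewrite (monalgE t); elim: (enum_fset _) => [|m s IHs].
  by rewrite big_nil; apply: lin_closed0 Klin K1.
rewrite big_cons; have -> : << t@_m *g m >> = t@_m *: << m >> :> {malg F[{fmonom I}]}.
  by apply/malgP => k; rewrite mcoeffZ !mcoeffU mulrnAr mulr1.
by apply: Klin => //; case: m {IHs} => m; apply: Kword.
Qed.

(* Arbitrary families of coefficients indexed by all exponents, rather than
   polynomials: only the nonvanishing of the vacuum is extracted from this model. *)
Section FockModel.
Variables (F : fieldType) (S : choiceType).

Definition fock := ((S -> nat) -> F^o).

Definition upd (al : S -> nat) (s : S) (n : nat) : S -> nat :=
  fun t => if t == s then n else al t.

Lemma updC al s t n m : s != t -> upd (upd al s n) t m = upd (upd al t m) s n.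
Proof.
move=> st; apply/funext => u; rewrite /upd; have [->|] // := eqVneq u t.
by rewrite eq_sym (negbTE st).
Qed.

Lemma upd_neq al s t n : t != s -> upd al s n t = al t.
Proof. by rewrite /upd => /negbTE ->. Qed.

Lemma upd_eq al s n : upd al s n s = n.
Proof. by rewrite /upd eqxx. Qed.

Lemma updd al s n m : upd (upd al s n) s m = upd al s m.
Proof. by apply/funext => u; rewrite /upd; case: (u == s). Qed.

Lemma upd_id al s : upd al s (al s) = al.
Proof. by apply/funext => u; rewrite /upd; case: eqP => // ->. Qed.

(** A common form for multiplication by the variable [s] and for differentiation: both touch only
    the exponent of [s], so operators in distinct variables commute by one computation. *)
Definition fock_fun s (c : nat -> F) (k : nat -> nat) (phi : fock) : fock :=
  fun al => c (al s) * phi (upd al s (k (al s))).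

Lemma fock_fun_linear s c k : linear (fock_fun s c k).
Proof.
move=> a phi phi'; apply/funext => al; rewrite /fock_fun.
rewrite -[(a *: phi + phi') _]/(a * phi _ + phi' _).
by rewrite -[RHS]/(a * (_ * phi _) + _ * phi' _) mulrDr mulrCA.
Qed.

Definition fock_op s c k : endo fock := Endo (fock_fun_linear s c k).

Lemma fock_op_comm s t c k d l : s != t -> comm (fock_op s c k) (fock_op t d l) = 0.
Proof.
move=> st; apply: endoP => phi; apply/funext => al; apply/eqP; rewrite subr_eq0; apply/eqP.
rewrite /= /fock_fun !upd_neq // 1?eq_sym // updC // mulrCA //.
Qed.

Definition fock_mul s := fock_op s (fun n => (n != 0)%:R) predn.
Definition fock_der s := fock_op s (fun n => n.+1%:R) succn.

Lemma fock_comm s : comm (fock_der s) (fock_mul s) = 1.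
Proof.
apply: endoP => phi; apply/funext => al.
rewrite -[LHS]/(fock_fun _ _ _ (fock_fun _ _ _ phi) al - fock_fun _ _ _ (fock_fun _ _ _ phi) al).
rewrite /fock_fun !upd_eq !updd /= mul1r upd_id -[RHS]/(phi al).
case E : (al s) => [|n] /=; first by rewrite mul0r subr0 mul1r.
by rewrite -{3}E upd_id mul1r -mulrBl [in n.+2%:R]mulrSr addrC addKr mul1r.
Qed.

Definition fock_vac : fock := fun al => (`[< forall s, al s = 0%N >])%:R.

Lemma fock_vac_neq0 : fock_vac <> 0.
Proof.
move=> /(congr1 (fun phi : fock => phi (fun=> 0%N))).
rewrite /fock_vac asboolT //; apply/eqP; exact: oner_neq0.
Qed.

Lemma fock_der_vac s : fock_der s fock_vac = 0.
Proof.
apply/funext => al; rewrite -[LHS]/(_ * fock_vac _) /fock_vac asboolF ?mulr0 //.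
by move=> /(_ s); rewrite upd_eq.
Qed.

End FockModel.

Arguments fock_vac : clear implicits.

Definition conj_idx (x : weyl_idx) : weyl_idx :=
  match x with inl n => inr (- n) | inr n => inl (- n) end.

Section WeylFockModule.
Variables (F : fieldType) (lam mu : nat -> F).

Local Notation V := (fock F weyl_idx).

(** Creation operators multiply by their own variable; annihilators differentiate in the conjugate
    variable and are shifted by the eigenvalue. The sign for [a^*] reflects [a^*(n), a(-n)] = -1. *)
Definition fock_weyl (x : weyl_idx) : endo V :=
  if annihilator x then
    (if x is inl _ then 1 else -1) *: fock_der F (conj_idx x) +
      whit_char lam mu x *: (1 : endo V)
  else fock_mul F x.

Lemma fock_weylC x y :
  comm (fock_weyl x) (fock_weyl y) = weyl_form F x y *: (1 : endo V).
Proof.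
have dd s t : comm (fock_der F s) (fock_der F t) = 0.
  by have [->|st] := eqVneq s t; [exact: commxx|exact: fock_op_comm].
have mm s t : comm (fock_mul F s) (fock_mul F t) = 0.
  by have [->|st] := eqVneq s t; [exact: commxx|exact: fock_op_comm].
have dm s t : comm (fock_der F s) (fock_mul F t) = (s == t)%:R *: (1 : endo V).
  have [->|st] := eqVneq s t; first by rewrite fock_comm scale1r.
  by rewrite scale0r fock_op_comm.
have am z t : annihilator z -> ~~ annihilator t ->
    comm (fock_weyl z) (fock_weyl t) = weyl_form F z t *: (1 : endo V).
  move=> hz ht; rewrite /fock_weyl hz (negbTE ht) commDl comm1l addr0 commZl dm scalerA.
  congr (_ *: _); case: z t {hz ht} => [n|n] [m|m] /=;
    rewrite ?mulr0 ?mul1r ?mulN1r ?oppr0 //.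
    by congr (_%:R); rewrite -[inr _ == inr _]/(- n == m) eq_sym -addr_eq0 addrC.
  by congr (- _%:R); rewrite -[inl _ == inl _]/(- n == m) eq_sym -addr_eq0 addrC.
have [hx|hx] := boolP (annihilator x); have [hy|hy] := boolP (annihilator y).
- rewrite /fock_weyl hx hy commDl comm1l addr0 commDr comm1 addr0 commZl commZr dd !scaler0.
  suff -> : weyl_form F x y = 0 by rewrite scale0r.
  by case: x y hx hy => [n|n] [m|m] //= hn hm; rewrite (_ : (n + m == 0) = false) ?oppr0 //; lia.
- exact: am.
- rewrite commC am // -scaleNr; congr (_ *: _).
  by case: x y {hx hy} => [n|n] [m|m] /=; rewrite ?oppr0 ?opprK // addrC.
rewrite /fock_weyl (negbTE hx) (negbTE hy) mm.
suff -> : weyl_form F x y = 0 by rewrite scale0r.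
by case: x y hx hy => [n|n] [m|m] //= hn hm; rewrite (_ : (n + m == 0) = false) ?oppr0 //; lia.
Qed.

Lemma fock_weyl_vac x : annihilator x ->
  fock_weyl x (fock_vac F weyl_idx) = whit_char lam mu x *: fock_vac F weyl_idx.
Proof.
move=> hx; rewrite /fock_weyl hx endoDE !endoZE endo1E fock_der_vac scaler0 add0r //.
Qed.

Local Notation vn0 := (@fock_vac_neq0 F weyl_idx).
Local Notation lift := (@free_lift F weyl_idx (endo_alg vn0) fock_weyl).

Lemma fock_lift_rels t : two_sided_ideal_gens (@weyl_rels F) t -> lift t = 0.
Proof.
case=> a [s [b [[x [y ->]] ->]]]; rewrite !rmorphM /= linearB /= linearB /= linearZ /=.
rewrite rmorph1 !(rmorphM (free_lift _)) /= !free_lift_gen.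
rewrite -[_ * _ - _ * _]/(comm (fock_weyl x) (fock_weyl y)) fock_weylC.
by rewrite subrr mulr0 mul0r.
Qed.

Definition fock_rep : weyl F -> endo_alg vn0 := quot_lift lift.

(** The left ideal defining M_1 kills the vacuum of the model, while 1 does not. *)
Lemma M1_vac_neq0 : M1_proj lam mu 1 <> 0.
Proof.
have repE t : fock_rep (quot_alg_proj _ t) = lift t.
  exact: quot_liftE fock_lift_rels t.
move=> /quot_proj_eq0 H.
have repM x y : fock_rep (x * y) = fock_rep x * fock_rep y.
  case: (quot_alg_proj_surj x) => u <-; case: (quot_alg_proj_surj y) => w <-.
  by rewrite -[_ * _ in LHS]rmorphM !repE rmorphM.
have rep_lin : linear fock_rep by exact: quot_lift_linear fock_lift_rels.
have rep_gen x : fock_rep (weyl_gen F x) = fock_weyl x by rewrite repE free_lift_gen.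
have rep1 : fock_rep 1 = 1 by rewrite -[1](rmorph1 (quot_alg_proj _)) repE rmorph1.
suff : forall y, y \in lin_span (left_ideal_gens (M1_gens lam mu)) ->
    (fock_rep y : endo V) (fock_vac F weyl_idx) = 0.
  by move=> /(_ _ H); rewrite rep1 => /vn0.
apply: lin_span_ind => [|c u w hu hw|_ [y [s [hs ->]]]].
- by rewrite -[0 in LHS](linear0 (quot_alg_proj (@weyl_rels F))) repE linear0.
- by rewrite rep_lin endoDE endoZE hu hw scaler0 addr0.
rewrite repM endoME; suff -> : (fock_rep s : endo V) (fock_vac F weyl_idx) = 0 by rewrite linear0.
have Z x : annihilator x -> (fock_rep (weyl_gen F x - whit_char lam mu x *: (1 : weyl F)) : endo V)
    (fock_vac F weyl_idx) = 0.
  move=> hx; rewrite addrC -scaleNr rep_lin rep1 rep_gen endoDE endoZE endo1E.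
  by rewrite fock_weyl_vac // scaleNr addNr.
by case: hs => [[i ->]|[j [j1 ->]]]; [apply: (Z (inl i%:Z))|apply: (Z (inr j%:Z))].
Qed.

End WeylFockModule.

(** * Tensor products and the concrete module *)

Section TensorBasics.
Variables (F : fieldType) (V W : lmodType F) (S : Type).
Variables (ract : V -> S -> V) (lact : S -> W -> W).
Local Notation pure := (pure_tensor ract lact).

Lemma pure_tensorPl c v v' w : pure (c *: v + v') w = c *: pure v w + pure v' w.
Proof.
rewrite /pure_tensor -linearP; apply/quot_projP/mem_lin_span.
by left; left; exists c, v, v', w.
Qed.

Lemma pure_tensorPr c v w w' : pure v (c *: w + w') = c *: pure v w + pure v w'.
Proof.
rewrite /pure_tensor -linearP; apply/quot_projP/mem_lin_span.
by left; right; exists c, v, w, w'.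
Qed.

Lemma pure_tensor_bal v s w : pure (ract v s) w = pure v (lact s w).
Proof. by apply/quot_projP/mem_lin_span; right; exists v, s, w. Qed.

Lemma tensor_ind (K : tensor ract lact -> Prop) :
  K 0 -> lin_closed K -> (forall v w, K (pure v w)) -> forall x, K x.
Proof.
move=> K0 KP Kp x; case: (quot_proj_surj x) => t <-.
rewrite (monalgE t) linear_sum; elim: (enum_fset _) => [|[v w] s IHs].
  by rewrite big_nil.
rewrite big_cons.
have -> : << t@_(v, w) *g (v, w) >> = t@_(v, w) *: << (v, w) >> :> {malg F[(V * W)%type]}.
  by apply/malgP => k; rewrite mcoeffZ !mcoeffU mulrnAr mulr1.
by rewrite linearZ; apply: KP => //; apply: Kp.
Qed.

Lemma tensor_lift (U : lmodType F) (b : V -> W -> U) :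
  (forall w, linear (b^~ w)) -> (forall v, linear (b v)) ->
  (forall v s w, b (ract v s) w = b v (lact s w)) ->
  exists f : {linear tensor ract lact -> U}, forall v w, f (pure v w) = b v w.
Proof.
move=> bl br bal.
pose f0 : {malg F[(V * W)%type]} -> U := lin_ext (fun vw : (V * W)%type => b vw.1 vw.2).
have f0U v w : f0 << (v, w) >> = b v w by apply: lin_extU.
have f0l : linear f0 by apply: lin_ext_linear.
pose f1 : {linear {malg F[(V * W)%type]} -> U} :=
  HB.pack f0 (GRing.isLinear.Build F _ U *:%R f0 f0l).
have f1rel t : tensor_rels ract lact t -> f1 t = 0.
  have f0B x y : f0 (x - y) = f0 x - f0 y by exact: (linearB f1).
  rewrite -[f1 t]/(f0 t); clear f1; clearbody f0.
  case=> [[[c [u [u' [w ->]]]]|[c [u [w [w' ->]]]]]|[u [s [w ->]]]].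
  - by rewrite f0B f0l 3!f0U bl subrr.
  - by rewrite f0B f0l 3!f0U br subrr.
  by rewrite f0B 2!f0U bal subrr.
have flin := quot_lift_linear f1rel.
pose f : {linear tensor ract lact -> U} := HB.pack (quot_lift f1 : tensor ract lact -> U)
  (GRing.isLinear.Build F (tensor ract lact) U *:%R _ flin).
exists f => v w; rewrite -[LHS]/(quot_lift f1 (quot_proj _ _)) (quot_liftE f1rel).
exact: f0U.
Qed.

End TensorBasics.

Section ScalarTensor.
Variables (F : fieldType) (V : lmodType F).

Let ract (v : V) (c : F) : V := c *: v.
Let lact (c : F) (w : F^o) : F^o := c *: w.
Local Notation pure := (pure_tensor ract lact).

Lemma pure_scale v c : pure v c = pure (c *: v) 1.
Proof.
rewrite -[c *: v]/(ract v c) pure_tensor_bal.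
by congr pure; rewrite /lact -[c *: _]/(c * 1) mulr1.
Qed.

Lemma pure1_surj (x : tensor ract lact) : exists v, x = pure v 1.
Proof.
elim/tensor_ind: x => [|c x y [u ->] [v ->]|v w].
- exists 0; have := pure_tensorPl ract lact (-1) 0 0 1.
  by rewrite scaler0 addr0 scaleN1r addNr => ->.
- by exists (c *: u + v); rewrite pure_tensorPl.
by exists (w *: v); apply: pure_scale.
Qed.

(** The map sending a pure tensor of [v] and [c] to [c *: v] is a left inverse. *)
Lemma pure1_eq0 v : pure v 1 = 0 -> v = 0.
Proof.
have [|||f fE] := @tensor_lift _ _ _ _ ract lact V (fun v (c : F^o) => (c : F) *: v).
- by move=> w c u u'; rewrite scalerDr !scalerA mulrC.
- by move=> u c w w'; rewrite -[_ + w']/(c * w + w') scalerDl scalerA.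
- by move=> u s w; rewrite /ract /lact scalerA mulrC.
by move=> E; have := fE v 1; rewrite E linear0 scale1r.
Qed.

End ScalarTensor.

Section ConcreteModule.
Variables (F : fieldType) (lam mu : nat -> F) (chi : int -> F).
Local Notation M1 := (M1 lam mu).
Local Notation M1L := (M1L lam mu).
Local Notation pure := (pure_tensor (@scalar_ract F lam mu) (@scalar_lact F)).

Definition M1L_in (v : M1) : M1L := pure v 1.

Lemma M1L_in_linear : linear M1L_in.
Proof. by move=> c u v; apply: pure_tensorPl. Qed.
HB.instance Definition _ := GRing.isLinear.Build F M1 M1L *:%R M1L_in M1L_in_linear.

Lemma pure_M1L_in v c : pure v c = M1L_in (c *: v).
Proof. exact: pure_scale. Qed.

Lemma M1L_in_surj (x : M1L) : exists v, x = M1L_in v.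
Proof. exact: pure1_surj. Qed.

Lemma M1L_in_eq0 v : M1L_in v = 0 -> v = 0.
Proof. exact: pure1_eq0. Qed.

Lemma M1_proj_surj (v : M1) : exists y, v = M1_proj lam mu y.
Proof. by case: (quot_proj_surj v) => y <-; exists y. Qed.

Lemma M1_act_linear x : linear (@M1_act F lam mu x).
Proof.
move=> c u v; have [y ->] := M1_proj_surj u; have [z ->] := M1_proj_surj v.
rewrite !M1_actE -[_ + _ in LHS](linearP (quot_proj _)) /=.
rewrite [LHS](@M1_actE F lam mu) mulrDr -quot_scaleAr.
by rewrite /M1_proj linearP.
Qed.

Definition M1_op x : endo M1 := Endo (M1_act_linear x).

Lemma M1L_heis_in n v : M1L_heis chi n (M1L_in v) = chi n *: M1L_in v.
Proof.
have hlin : linear (Lchi_act chi n).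
  move=> c u w; rewrite /Lchi_act -[c *: u]/(c * u) -[c *: (_ * u)]/(c * (chi n * u)).
  by rewrite mulrDr mulrCA.
rewrite /M1L_heis /M1L_in.
have := @tensor_mapE _ _ _ _ _ _ (@scalar_ract F lam mu) (@scalar_lact F)
  (@scalar_ract F lam mu) (@scalar_lact F) idfun (Endo hlin : endo F^o).
move=> -> //; last by move=> s w; rewrite /= /Lchi_act /scalar_lact -!/(_ * _) mulrCA.
by rewrite /= !pure_M1L_in /Lchi_act mulr1 -linearZ /= scale1r.
Qed.

Definition M1_weyl (x : weyl_idx) : endo M1 := M1_op (weyl_gen F x).

Lemma M1_weyl_proj x y : M1_weyl x (M1_proj lam mu y) = M1_proj lam mu (weyl_gen F x * y).
Proof. exact: M1_actE. Qed.

Lemma M1_projP c y z : M1_proj lam mu (c *: y + z) = c *: M1_proj lam mu y + M1_proj lam mu z.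
Proof. exact: quot_proj_linear. Qed.

Lemma M1_projB y z : M1_proj lam mu (y - z) = M1_proj lam mu y - M1_proj lam mu z.
Proof. exact: quot_projB. Qed.

Lemma M1_projZ c y : M1_proj lam mu (c *: y) = c *: M1_proj lam mu y.
Proof. exact: quot_projZ. Qed.

Lemma M1_weylC x y : comm (M1_weyl x) (M1_weyl y) = weyl_form F x y *: (1 : endo M1).
Proof.
apply: endoP => v; have [z ->] := M1_proj_surj v.
rewrite endoDE endoNE !endoME !M1_weyl_proj endoZE endo1E.
rewrite -M1_projB -M1_projZ; congr M1_proj.
by rewrite !mulrA -mulrBl weyl_genC -quot_scaleAl mul1r.
Qed.

Definition M1_vac : M1 := M1_proj lam mu 1.

Lemma M1_vac_whit x : annihilator x -> M1_weyl x M1_vac = whit_char lam mu x *: M1_vac.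
Proof.
move=> hx; rewrite /M1_vac M1_weyl_proj mulr1 -M1_projZ; apply/quot_projP/mem_lin_span.
exists 1, (weyl_gen F x - whit_char lam mu x *: (1 : weyl F)); rewrite mul1r; split=> //.
case: x hx => n /= hn; [left; exists (absz n)|right; exists (absz n)].
  by have -> : Posz (absz n) = n by lia.
split; first by lia.
by have -> : Posz (absz n) = n by lia.
Qed.

Lemma M1_cyclic (K : M1 -> Prop) : lin_closed K -> K M1_vac ->
  (forall x w, K w -> K (M1_weyl x w)) -> forall w, K w.
Proof.
move=> KP K0 Kg w; have [y ->] := M1_proj_surj w.
case: (quot_alg_proj_surj y) => t <-.
elim/free_alg_ind: t => [c s t hs ht||x t ht].
- by rewrite linearP M1_projP; apply: KP.
- by rewrite rmorph1.
have -> : quot_alg_proj (@weyl_rels F) (free_gen F x * t) =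
    weyl_gen F x * quot_alg_proj (@weyl_rels F) t by exact: rmorphM.
by rewrite -M1_weyl_proj; apply: Kg.
Qed.

Lemma M1L_weyl_in x v : M1L_weyl (lam := lam) (mu := mu) x (M1L_in v) = M1L_in (M1_weyl x v).
Proof.
rewrite /M1L_weyl /M1L_in.
apply: (@tensor_mapE _ _ _ _ _ _ _ _ _ _ (M1_weyl x) idfun) => // u s.
exact: linearZ.
Qed.

Lemma M1L_heisE n w : M1L_heis (lam := lam) (mu := mu) chi n w = chi n *: w.
Proof. by have [v ->] := M1L_in_surj w; apply: M1L_heis_in. Qed.

End ConcreteModule.

Section Transfer.
Variables (F : fieldType) (V W : lmodType F) (io : {linear V -> W}).
Hypothesis io_surj : forall w, exists v, w = io v.
Variables (T : weyl_idx -> endo V) (U : weyl_idx -> W -> W).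
Hypothesis UE : forall x v, U x (io v) = io (T x v).

(** [U] is given as a mere function; its linearity comes from the surjectivity of [io]. *)
Lemma transfer_linear x : linear (U x).
Proof.
move=> c u v; have [u' ->] := io_surj u; have [v' ->] := io_surj v.
by rewrite -linearP !UE linearP linearP.
Qed.

Definition transfer x : endo W := Endo (transfer_linear x).

Lemma transferE x v : transfer x (io v) = io (T x v). Proof. exact: UE. Qed.

Lemma transferC (f : weyl_idx -> weyl_idx -> F) :
  (forall x y, comm (T x) (T y) = f x y *: (1 : endo V)) ->
  forall x y, comm (transfer x) (transfer y) = f x y *: (1 : endo W).
Proof.
move=> TC x y; apply: endoP => u; have [v ->] := io_surj u.
rewrite endoDE endoNE !endoME !transferE -linearB.
by rewrite -[T x _ - _]/(comm (T x) (T y) v) TC endoZE linearZ.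
Qed.

Lemma transfer_cyclic v0 : (forall K : V -> Prop, lin_closed K -> K v0 ->
    (forall x w, K w -> K (T x w)) -> forall w, K w) ->
  forall K : W -> Prop, lin_closed K -> K (io v0) ->
    (forall x w, K w -> K (transfer x w)) -> forall w, K w.
Proof.
move=> HT K KP K0 Kg w; have [v ->] := io_surj w.
apply: (HT (fun v => K (io v))) => // [c u t hu ht|x t ht].
  by rewrite linearP; apply: KP.
by rewrite -transferE; apply: Kg.
Qed.

End Transfer.

(** * Simple quotients of induced modules *)

Lemma uea_ind (F : fieldType) (L : lieAlgType F) (K : uea L -> Prop) :
  lin_closed K -> K 1 -> (forall x s, K s -> K (uea_in x * s)) -> forall s, K s.
Proof.
move=> KP K1 Kg s; case: (quot_alg_proj_surj s) => t <-.
elim/free_alg_ind: t => [c u w hu hw||x t ht].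
- have -> : quot_alg_proj (@uea_rels F L) (c *: u + w) =
      c *: quot_alg_proj (@uea_rels F L) u + quot_alg_proj (@uea_rels F L) w by exact: linearP.
  exact: KP.
- by rewrite (rmorph1 (quot_alg_proj (@uea_rels F L))).
have -> : quot_alg_proj (@uea_rels F L) (free_gen F x * t) =
    uea_in x * quot_alg_proj (@uea_rels F L) t by exact: rmorphM.
exact: Kg.
Qed.

Section InducedQuotient.
Variables (F : fieldType) (L : lieAlgType F) (S : set L) (V : lmodType F).
Variables (rh : {linear L -> endo V}) (v0 : V).
Hypothesis rh_lie : forall x y, rh (lie x y) = comm (rh x) (rh y).
Hypothesis v0n0 : v0 <> 0.

Lemma eigenvalue_inj (a b : F) : a *: v0 = b *: v0 -> a = b.
Proof.
move/eqP; rewrite -subr_eq0 -scalerBl scaler_eq0 subr_eq0 => /orP [/eqP //|/eqP].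
by move/v0n0.
Qed.

Lemma lie_eigen x y a b : rh x v0 = a *: v0 -> rh y v0 = b *: v0 -> rh (lie x y) v0 = 0.
Proof.
move=> hx hy; rewrite rh_lie /comm endoDE endoNE !endoME hx hy.
have -> : rh x (b *: v0) = (a * b) *: v0 by rewrite linearZ /= hx scalerA mulrC.
by rewrite linearZ /= hy scalerA subrr.
Qed.

Lemma lie_span_eigen (K : L -> Prop) : K 0 -> lin_closed K ->
  (forall x y, K x -> K y -> K (lie x y)) -> (forall x, S x -> K x) ->
  forall x : lie_sub S, K (val x).
Proof.
move=> K0 KP Kl KS [x /asboolP hx] /=.
pose W : {pred L} := fun u => `[< K u >].
have Wc : submod_closed W.
  split; first exact/asboolP.
  by move=> c u v /asboolP Ku /asboolP Kv; apply/asboolP; apply: KP.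
pose W' : submodClosed L := HB.pack W (GRing.isSubmodClosed.Build F L W Wc).
have : x \in W'.
  apply: (hx W') => [u v /asboolP Ku /asboolP Kv|u Su]; apply/asboolP; first exact: Kl.
  exact: KS.
by move/asboolP.
Qed.

(** The eigenvector property passes to brackets, which act by 0 in accordance with the zero bracket
    on [F^o]. Since [v0 <> 0], the eigenvalue is unique, hence linear in [x]. *)
Lemma eigen_character : (forall x, S x -> exists c, rh x v0 = c *: v0) ->
  exists psi : lie_hom (lie_sub S) F^o, forall x, rh (val x) v0 = (psi x : F) *: v0.
Proof.
move=> HS.
have HP (x : lie_sub S) : exists c : F, rh (val x) v0 = c *: v0.
  apply: (lie_span_eigen (K := fun x => exists c : F, rh x v0 = c *: v0)) => //.
  - by exists 0; rewrite linear0 scale0r.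
  - move=> c u w [a ha] [b hb]; exists (c * a + b).
    by rewrite linearP endoDE endoZE ha hb scalerA scalerDl.
  - by move=> u w [a ha] [b hb]; exists 0; rewrite scale0r; apply: lie_eigen ha hb.
pose p (x : lie_sub S) : F^o := projT1 (cid (HP x)).
have pE x : rh (val x) v0 = (p x : F) *: v0 by rewrite /p; case: (cid _).
have plin : linear p.
  move=> c u w; apply: eigenvalue_inj; rewrite -pE !linearP endoDE endoZE !pE.
  by rewrite scalerA -scalerDl.
pose p' : {linear lie_sub S -> F^o} := HB.pack p (GRing.isLinear.Build F _ F^o *:%R p plin).
have phom x y : p' (lie x y) = p' x * p' y - p' y * p' x.
  apply: eigenvalue_inj; rewrite -[p' _]/(p _) -pE [lie x y]/(sub_lie x y) /=.
  by rewrite (lie_eigen (pE x) (pE y)) mulrC subrr scale0r.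
by exists (LieHom phom).
Qed.

Variable psi : lie_hom (lie_sub S) F^o.

Lemma character_eigen :
  (forall x : lie_sub S, S (val x) -> rh (val x) v0 = (psi x : F) *: v0) ->
  forall x : lie_sub S, rh (val x) v0 = (psi x : F) *: v0.
Proof.
move=> HS.
(* Induction over the span concerns elements of [L], where [psi] is not defined; hence the detour
   through a preimage [y]. *)
have : forall x : lie_sub S, exists y : lie_sub S,
    val y = val x /\ rh (val y) v0 = (psi y : F) *: v0.
  apply: (lie_span_eigen (K := fun x => exists y : lie_sub S,
    val y = x /\ rh (val y) v0 = (psi y : F) *: v0)).
  - by exists 0; rewrite !linear0 scale0r.
  - move=> c _ _ [u [<- hu]] [w [<- hw]]; exists (c *: u + w); rewrite !linearP.
    by rewrite endoDE endoZE hu hw scalerA -scalerDl.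
  - move=> _ _ [u [<- hu]] [w [<- hw]]; exists (lie u w); split=> //.
    by rewrite (lie_eigen hu hw) lie_homE mulrC subrr scale0r.
  - by move=> x Sx; exists (LieSub (mem_lie_span Sx)); split=> //; apply: HS.
by move=> H x; have [y [/val_inj <-]] := H x.
Qed.

Hypothesis psi_eigen : forall x : lie_sub S, rh (val x) v0 = (psi x : F) *: v0.
Hypothesis Vsimple : simple_module (fun x v => rh x v).

Local Notation A := (endo_alg v0n0).

Lemma rh_hom x y : (rh (lie x y) : A) = (rh x : A) * (rh y : A) - (rh y : A) * (rh x : A).
Proof. exact: rh_lie. Qed.

Definition rh_alg : L -> A := rh.
Lemma rh_alg_linear : linear rh_alg. Proof. exact: linearP. Qed.
HB.instance Definition _ := GRing.isLinear.Build F L A *:%R rh_alg rh_alg_linear.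
Definition rh_lie_hom : lie_hom L A := @LieHom F L A rh_alg rh_hom.

Definition uea_act (u : uea L) : endo V := uea_lift rh_lie_hom u.

Lemma uea_act_linear : linear uea_act. Proof. by move=> c u w; exact: (uea_lift_linear rh_lie_hom c u w). Qed.
Lemma uea_actM u w : uea_act (u * w) = uea_act u * uea_act w.
Proof. exact: (rmorphM (uea_lift rh_lie_hom)). Qed.
Lemma uea_act1 : uea_act 1 = 1.
Proof. exact: (rmorph1 (uea_lift rh_lie_hom)). Qed.
Lemma uea_act_in x : uea_act (uea_in x) = rh x.
Proof. exact: (uea_lift_in rh_lie_hom x). Qed.

Lemma uea_act_inM x u v : uea_act (uea_in x * u) v = rh x (uea_act u v).
Proof. by rewrite uea_actM uea_act_in. Qed.

(** The balancing condition that lets [(u, c) -> c *: uea_act u v0] factor through the tensor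
    product over U(P). *)
Lemma uea_act_psi (s : uea (lie_sub S)) :
  uea_act (uea_lift (uea_incl S) s) v0 = (uea_lift psi s : F) *: v0.
Proof.
elim/uea_ind: s => [c u w hu hw||x s hs].
- rewrite (uea_lift_linear psi c u w) (uea_lift_linear (uea_incl S) c u w).
  move: hu hw; move: (uea_lift (uea_incl S) u) (uea_lift (uea_incl S) w) => a b.
  move: (uea_lift psi u) (uea_lift psi w) => d e hu hw.
  by rewrite uea_act_linear endoDE endoZE hu hw scalerA -scalerDl.
- by rewrite (rmorph1 (uea_lift psi)) (rmorph1 (uea_lift (uea_incl S))) uea_act1 scale1r.
have -> : uea_lift (uea_incl S) (uea_in x * s) = uea_in (val x) * uea_lift (uea_incl S) s.
  by rewrite (rmorphM (uea_lift (uea_incl S))) /= uea_lift_in.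
have -> : uea_lift psi (uea_in x * s) = psi x * uea_lift psi s.
  by rewrite (rmorphM (uea_lift psi)) /= uea_lift_in.
by rewrite uea_actM endoME hs uea_act_in linearZ /= psi_eigen scalerA mulrC.
Qed.

Local Notation pure := (pure_tensor (@uea_ract F L S) (@char_lact F L S psi)).

Lemma induced_pure1 (t : induced psi) : exists u, t = pure u 1.
Proof.
have p0 w : pure 0 w = 0.
  have := pure_tensorPl (@uea_ract F L S) (@char_lact F L S psi) (-1) 0 0 w.
  by rewrite scaler0 addr0 scaleN1r addNr => ->.
have p0' u : pure u 0 = 0.
  have := pure_tensorPr (@uea_ract F L S) (@char_lact F L S psi) (-1) u 0 0.
  by rewrite scaler0 addr0 scaleN1r addNr => ->.
elim/tensor_ind: t => [|c _ _ [u ->] [w ->]|u c].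
- by exists 0.
- by exists (c *: u + w); rewrite pure_tensorPl.
exists (c *: u); rewrite -[c *: u]addr0 pure_tensorPl p0.
rewrite -{1}[c]mulr1 -[c * 1]/(c *: (1 : F^o)) -[c *: _]addr0.
by rewrite pure_tensorPr p0'.
Qed.

Lemma induced_quotient : quotient_module (@induced_act F L S psi) (fun x v => rh x v).
Proof.
have [|||f fE'] := @tensor_lift _ _ _ _ (@uea_ract F L S) (@char_lact F L S psi) V
    (fun u (c : F^o) => (c : F) *: uea_act u v0).
- by move=> c d u w; rewrite uea_act_linear endoDE endoZE scalerDr !scalerA mulrC.
- by move=> u c w w'; rewrite -[_ + w']/(c * w + w') scalerDl scalerA.
- move=> u s w; rewrite /uea_ract uea_actM endoME uea_act_psi linearZ /= scalerA.
  by rewrite /char_lact mulrC.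
have fE u : f (pure u 1) = uea_act u v0 by rewrite fE' scale1r.
have feq x t : f (@induced_act F L S psi x t) = rh x (f t).
  have [u ->] := induced_pure1 t.
  have e1 := f_equal f (induced_actE psi x u 1).
  have e2 := fE (uea_in x * u).
  have e3 := uea_act_inM x u v0.
  have e4 := f_equal (rh x : V -> V) (esym (fE u)).
  have e12 := etrans e1 e2.
  have e34 := etrans e3 e4.
  exact: (etrans e12 e34).
(* [W] is the image of [f]; it contains [v0], the image of [pure 1 1]. *)
exists f; split=> // w; pose W : {pred V} := fun v => `[< exists t, f t = v >].
have [] := (proj2 Vsimple) W.
- split; first by apply/asboolP; exists 0; rewrite linear0.
  move=> c u v /asboolP [s <-] /asboolP [t <-]; apply/asboolP.
  by exists (c *: s + t); rewrite linearP.
- by move=> x v /asboolP [t <-]; apply/asboolP; exists (@induced_act F L S psi x t); apply: feq.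
- move=> /(_ v0) E; case: v0n0; apply: E; apply/asboolP; exists (pure 1 1).
  by rewrite fE uea_act1.
by move=> /(_ w) /asboolP.
Qed.

End InducedQuotient.

(** * The Wakimoto module and the theorem *)

Section WakimotoModuleOperators.
Variables (F : fieldType) (lam mu : nat -> F) (chi : int -> F).

Definition M1L_op : weyl_idx -> endo (M1L lam mu) :=
  transfer (@M1L_in_surj F lam mu) (@M1L_weyl_in F lam mu).
Definition M1L_vac : M1L lam mu := M1L_in (M1_vac lam mu).

Lemma M1L_opC x y :
  comm (M1L_op x) (M1L_op y) = weyl_form F x y *: (1 : endo (M1L lam mu)).
Proof. by apply: transferC; apply: M1_weylC. Qed.

Lemma M1L_vac_whit x : annihilator x -> M1L_op x M1L_vac = whit_char lam mu x *: M1L_vac.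
Proof. by move=> hx; rewrite /M1L_vac transferE M1_vac_whit // linearZ. Qed.

Lemma M1L_vac_neq0 : M1L_vac <> 0.
Proof. by move/M1L_in_eq0; apply: M1_vac_neq0. Qed.

Lemma M1L_cyclic (K : M1L lam mu -> Prop) : lin_closed K -> K M1L_vac ->
  (forall x w, K w -> K (M1L_op x w)) -> forall w, K w.
Proof. by apply: transfer_cyclic; apply: M1_cyclic. Qed.

Lemma M1L_actE x w : M1L_act chi x w =
  wakimoto_act (fun n => M1L_op (inl n)) (fun n => M1L_op (inr n)) (fun n w => chi n *: w) x w.
Proof.
rewrite /M1L_act; congr (wakimoto_act _ _ _ x w).
by apply/funext => n; apply/funext => u; apply: M1L_heisE.
Qed.

End WakimotoModuleOperators.

Theorem theorem7p7 (R : realType) (lam mu eta : nat -> R[i]) (chi : int -> R[i])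
    (N M P : nat)
    (hM : (1 <= M)%N)
    (hlam : lam N <> 0) (hlam0 : forall i : nat, (0 < i)%N -> lam (N + i)%N = 0)
    (hmu : mu M <> 0) (hmu0 : forall i : nat, (0 < i)%N -> mu (M + i)%N = 0)
    (heta : eta P <> 0) (heta0 : forall i : nat, (0 < i)%N -> eta (P + i)%N = 0)
    (hchi0 : forall n : int, P%:Z < n -> chi n = 0)
    (hchiP : chi P%:Z <> 0)
    (hchi : forall i : nat, chi i%:Z = eta i) :
  let q := maxn M N.+1 in
  let r := maxn (maxn (M + N + 1) (2 * M)) P.+1 in
  let is_psi (psi : lie_hom (whit_alg R[i] q r) (R[i])^o) :=
    [/\ psi (whit_K R[i] q r) = -2,
        forall i : nat, psi (whit_e R[i] q r i) = lam i,
        forall i : nat, psi (whit_h R[i] q r i) =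
          (-2) * (\sum_(1 <= l < M.+1) mu l * lam (q + i - l)%N) + eta (q + i)%N &
        forall i : nat, psi (whit_f R[i] q r i) =
          - (\sum_(0 <= k1 < (r + i).+1) \sum_(0 <= k2 < (r + i).+1)
             \sum_(0 <= k3 < (r + i).+1 |
               [&& (1 <= k1)%N, (1 <= k2)%N & (k1 + k2 + k3 == r + i)%N])
               mu k1 * mu k2 * lam k3)
          + (\sum_(0 <= j1 < (r + i).+1) \sum_(0 <= j2 < (r + i).+1 |
               (1 <= j1)%N && (j1 + j2 == r + i)%N) mu j1 * eta j2)
          + 2 * (r + i)%N%:R * mu (r + i)%N] in
  (exists psi, is_psi psi) /\
  forall psi, is_psi psi ->
    [/\ affine_vertex_module (-2) (@M1L_act R[i] lam mu chi),
        simple_module (@M1L_act R[i] lam mu chi) &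
        quotient_module (@whittaker_act R[i] q r psi) (@M1L_act R[i] lam mu chi)].
Proof.
move=> q r is_psi.
pose g := M1L_op lam mu; pose v0 := M1L_vac lam mu.
have gC x y : comm (g x) (g y) = weyl_form R[i] x y *: (1 : endo (M1L lam mu)).
  exact: M1L_opC.
have char0 n : (n.+1%:R : R[i]) != 0 by rewrite pnatr_eq0.
have lamN i : (N < i)%N -> lam i = 0.
  by move=> Ni; rewrite -(subnKC (ltnW Ni)) hlam0 // subn_gt0.
have muM i : (M < i)%N -> mu i = 0.
  by move=> Mi; rewrite -(subnKC (ltnW Mi)) hmu0 // subn_gt0.
have v0n0 : v0 <> 0 by exact: M1L_vac_neq0.
have v0w x : annihilator x -> g x v0 = whit_char lam mu x *: v0 by exact: M1L_vac_whit.
have lamT : exists N, forall i, (N < i)%N -> lam i = 0 by exists N.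
have muT : exists M, forall i, (M < i)%N -> mu i = 0 by exists M.
have chiT : exists P : nat, forall n : int, P%:Z < n -> chi n = 0 by exists P.
have cyc := @M1L_cyclic _ lam mu.
have gS := weyl_smooth gC v0w lamT muT cyc.
have actE : @M1L_act R[i] lam mu chi = fun x w => rho g chi x w.
  by apply/funext => x; apply/funext => w; rewrite M1L_actE wakimoto_actE.
have rl := rho_lie gC gS chiT char0.
have vK : rho g chi (hat_K R[i]) v0 = -2 *: v0 by rewrite /hat_K rhoU.
have ve i : rho g chi (hat_e R[i] i%:Z) v0 = lam i *: v0.
  by rewrite /hat_e rho_loopU; apply: (Av0 v0w).
(* The definitions of [q] and [r] supply the bounds required by [H_v0] and [F_v0]. *)
have vh i := H_v0 gC gS v0w lamN muM hchi hM (n := (q + i)%N) ltac:(lia) ltac:(lia).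
have vf i := F_v0 gC gS v0w lamN muM hchi0 hchi hM (n := (r + i)%N)
  ltac:(lia) ltac:(lia) ltac:(lia).
have rhoE n : rho g chi (hat_h R[i] n) = Hop g chi n by exact: rho_loopU.
have vh' i := etrans (congr1 (fun e : endo _ => e v0) (rhoE (q + i)%N%:Z)) (vh i).
have {}rhoE n : rho g chi (hat_f R[i] n) = Fop g chi n by exact: rho_loopU.
have vf' i := etrans (congr1 (fun e : endo _ => e v0) (rhoE (r + i)%N%:Z)) (vf i).
have simp : simple_module (fun x v => rho g chi x v).
  by apply: (rho_simple gC char0 v0w lamT muT cyc chi v0n0 (N := N)) => //; apply/eqP.
split.
  have [x [[[->|[n ->]]|[m [qm ->]]]|[p [rp ->]]]|psi psiE] :=
      eigen_character (S := @whit_gens R[i] q r) rl v0n0.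
  - by exists (-2); exact: vK.
  - by exists (lam n); exact: ve.
  - by rewrite -(subnKC qm); eexists; exact: vh'.
  - by rewrite -(subnKC rp); eexists; exact: vf'.
  (* The eigenvalue on [v0] is unique, so the values of [psi] are read off from the operators. *)
  exists psi; split=> [|i|i|i]; apply: (eigenvalue_inj v0n0); rewrite -psiE.
  - exact: vK.
  - exact: ve.
  - exact: vh'.
  - exact: vf'.
move=> psi [pK pe ph pf]; rewrite actE; split.
- split; [exact: (rho_lie_module gC gS chiT char0)|exact: (rho_smooth gC gS chiT)|].
  by move=> v; exact: (congr1 (fun e : endo _ => e v) (rhoU g chi None)).
- exact: simp.
apply: (induced_quotient rl v0n0 _ simp).
apply: (character_eigen rl) => -[x hx] /= Sx.
case: Sx hx => [[[->|[n ->]]|[m [qm ->]]]|[p [rp ->]]] hx.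
- have -> : LieSub hx = whit_K R[i] q r by apply: val_inj.
  by rewrite pK.
- have -> : LieSub hx = whit_e R[i] q r n by apply: val_inj.
  by rewrite pe; apply: ve.
- have -> : LieSub hx = whit_h R[i] q r (m - q)%N by apply: val_inj; rewrite /= subnKC.
  by rewrite ph -vh' subnKC.
have -> : LieSub hx = whit_f R[i] q r (p - r)%N by apply: val_inj; rewrite /= subnKC.
by rewrite pf -vf' subnKC.
Qed.
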